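(* Let $\mathfrak{g}$ be a complete (pro-nilpotent) Lie algebra over a field of characteristic zero, with Baker–Campbell–Hausdorff product $x\bullet y=\log(e^xe^y)$. Then for all $x,y\in\mathfrak{g}$, \[ x\bullet y=\sum_T\frac{E_TK_T}{l_T!\,r_T!}\,T(x,y), \] the sum running over all planar binary rooted trees $T$.
   Context: Planar binary rooted trees have a univalent root; $|$ is the one-leaf tree; edges to right (left) children are right (left) pointing, the root edge counts as right pointing. For $T\ne|$, $r_T$ ($l_T$) is the number of right (left) pointing leaves; for $T=|$, $r_T=1$, $l_T=0$. For an edge $e$ of $T'$, $T\searrow_eT'$ subdivides $e$ by a new vertex with right child the part of $T'$ above $e$ and left child $T$; $T\rhd T'=\sum_{e\text{ right}}T\searrow_eT'-\sum_{e\text{ left}}T\searrow_eT'$ on $\mathcal{T}_{\mathrm{pb}}=\prod_n\mathcal{T}_{\mathrm{pb}}(n)$ ($n$ = number of leaves). The Eulerian coefficients $E_T$ are given by $\sum_TE_TT=X$, $X$ the unique element with $\sum_{m\ge1}\frac{(-1)^{m+1}}{m!}X\rhd(X\rhd(\cdots\rhd X))=|$ ($m$ factors). $K_T$ is the number of labelings of the leaves of $T$ by $\{1,\ldots,|T|\}$ ($|T|$ = number of leaves) that are bijective, admissible (for every inner vertex $v$, among leaves descending from $v$ the leftmost has the minimal and the rightmost the maximal label) and such that every left pointing leaf has a smaller label than every right pointing leaf. $T(x,y)\in\mathfrak{g}$ is obtained by labeling left pointing leaves by $x$, right pointing leaves by $y$, and reading $T$ as an iterated bracket ([left subtree, right subtree]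 at each inner vertex); by convention $|(x,y)=x+y$.
   Formalization: For a left pointing edge e, the new vertex of T↘_eT' has the part of T' above e as left child and T as right child (for right pointing e as described); with T always as left child the formula fails in degree 5, at the word xyyyy. *)

(* Defs.v *)
From HB Require Import structures.
From mathcomp Require Import all_boot all_order all_algebra.
From mathcomp Require Import boolp classical_sets functions.

Set Implicit Arguments.
Unset Strict Implicit.
Unset Printing Implicit Defensive.

Import GRing.Theory.
Local Open Scope ring_scope.

(** * Planar binary rooted trees *)

Inductive pbtree : Type := Leaf | Node of pbtree & pbtree.

Fixpoint pbtree_eqb (s t : pbtree) : bool :=
  match s, t with
  | Leaf, Leaf => true
  | Node a b, Node c d => pbtree_eqb a c && pbtree_eqb b d
  | _, _ => false
  end.

Lemma pbtree_eqP : Equality.axiom pbtree_eqb.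
Proof.
elim=> [|a IHa b IHb] [|c d] /=; try by constructor.
by apply: (iffP andP) => [[/IHa-> /IHb->]|[<- <-]] //; split; [apply/IHa|apply/IHb].
Qed.

HB.instance Definition _ := hasDecEq.Build pbtree pbtree_eqP.

Fixpoint nleaves (t : pbtree) : nat :=
  if t is Node a b then (nleaves a + nleaves b)%N else 1%N.

(* A vertex is given by the path leading to it from the root edge: false goes
   to the left child, true to the right child. An edge is identified with the
   vertex at its upper end, so that [::] stands for the root edge. *)
Fixpoint edges (t : pbtree) : seq (seq bool) :=
  if t is Node a b then
    [::] :: map (cons false) (edges a) ++ map (cons true) (edges b)
  else [:: [::]].

(* The leaves, from left to right. *)
Fixpoint leaves (t : pbtree) : seq (seq bool) :=
  if t is Node a b then map (cons false) (leaves a) ++ map (cons true) (leaves b)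
  else [:: [::]].

(* The root edge, in particular the unique edge of Leaf, is right pointing. *)
Definition right_pointing (e : seq bool) : bool := last true e.
Definition left_pointing (e : seq bool) : bool := ~~ right_pointing e.

Definition nright (t : pbtree) : nat := count right_pointing (leaves t).
Definition nleft (t : pbtree) : nat := count left_pointing (leaves t).

(* Grafting s onto the edge e of t. The new vertex subdivides e into two edges
   which both point in the direction of e; s sits on the other side. Thus s is
   the left child of the new vertex when e is right pointing, and its right
   child when e is left pointing. *)
Fixpoint graft_rec (dir : bool) (s : pbtree) (e : seq bool) (t : pbtree) :=
  match e, t with
  | false :: e', Node a b => Node (graft_rec false s e' a) b
  | true :: e', Node a b => Node a (graft_rec true s e' b)
  | _, _ => if dir then Node s t else Node t s
  end.
Definition graft (s : pbtree) (e : seq bool) (t : pbtree) : pbtree :=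
  graft_rec true s e t.

(* All trees of height at most h. *)
Fixpoint trees_upto (h : nat) : seq pbtree :=
  if h is h'.+1 then
    Leaf :: [seq Node a b | a <- trees_upto h', b <- trees_upto h']
  else [::].

Definition trees (n : nat) : seq pbtree :=
  [seq t <- trees_upto n | nleaves t == n].

Lemma nleaves_gt0 t : (0 < nleaves t)%N.
Proof. by elim: t => //= a IHa b _; rewrite addn_gt0 IHa. Qed.

Lemma mem_trees_upto h t : (nleaves t <= h)%N -> t \in trees_upto h.
Proof.
elim: h t => [|h IH] t; first by rewrite leqNgt nleaves_gt0.
case: t => [|a b] //= le_h; rewrite inE /=; apply/allpairsP; exists (a, b).
have [a0 b0] := (nleaves_gt0 a, nleaves_gt0 b).
split=> //=; apply: IH; rewrite -ltnS; apply: leq_trans le_h.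
  by rewrite -addn1 leq_add2l.
by rewrite -add1n leq_add2r.
Qed.

Lemma mem_trees n t : (t \in trees n) = (nleaves t == n).
Proof.
rewrite mem_filter; case: eqP => //= <-.
exact: mem_trees_upto.
Qed.

Lemma trees_uniq n : uniq (trees n).
Proof.
apply: filter_uniq; elim: n => //= h IH; apply/andP; split.
  by apply/negP => /allpairsP[[a b] []].
by apply: allpairs_uniq => // -[a b] [c d] _ _ /= [-> ->].
Qed.

(** * Formal series of trees, and the Eulerian coefficients *)

Section TreeSeries.
Variable k : fieldType.

(* The element of the product, over n, of the spans of the trees with n leaves
   in which the tree t has coefficient A t. *)
Definition tree_series := pbtree -> k.

(* s |> t *)
Definition prelie_tree (s t : pbtree) : tree_series := fun u =>
  \sum_(e <- edges t) (if right_pointing e then 1 else -1) * (graft s e t == u)%:R.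

(* The bilinear extension of prelie_tree. Grafting adds numbers of leaves, so
   only pairs (s, t) with nleaves s + nleaves t = nleaves u contribute to u. *)
Definition prelie (A B : tree_series) : tree_series := fun u =>
  \sum_(1 <= i < nleaves u) \sum_(s <- trees i) \sum_(t <- trees (nleaves u - i))
     A s * B t * prelie_tree s t u.

(* X |> (X |> (... |> X)) with m.+1 factors. *)
Definition prelie_pow (X : tree_series) (m : nat) : tree_series :=
  iter m (prelie X) X.

Definition tree_unit : tree_series := fun u => (u == Leaf)%:R.

(* The product of m series has no term with fewer than m leaves, so the sum
   over m is finite in each coefficient. *)
Definition eulerian_equation (X : tree_series) : Prop := forall u,
  \sum_(1 <= m < (nleaves u).+1) (-1) ^+ m.+1 / m`!%:R * prelie_pow X m.-1 u
  = tree_unit u.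

Definition eulerian : tree_series := xget tree_unit [set X | eulerian_equation X].

Definition agree n (A B : tree_series) := forall t, (nleaves t < n)%N -> A t = B t.

Lemma agreeW n m A B : (m <= n)%N -> agree n A B -> agree m A B.
Proof. by move=> le AB t lt; apply: AB; apply: leq_trans le. Qed.

Lemma prelie_local n A A' B B' : agree n A A' -> agree n B B' ->
  agree n.+1 (prelie A B) (prelie A' B').
Proof.
move=> AA BB u; rewrite ltnS => un; rewrite /prelie.
apply: eq_big_nat => i /andP[i0 iu].
apply: eq_big_seq => s; rewrite mem_trees => /eqP si.
apply: eq_big_seq => t; rewrite mem_trees => /eqP ti.
rewrite AA ?BB // ?si ?ti; apply: leq_trans un => //.
by rewrite ltn_subrL i0 (ltn_trans i0 iu).
Qed.

Lemma prelie_pow_local n A B m :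
  agree n A B -> agree (n + (0 < m)%N) (prelie_pow A m) (prelie_pow B m).
Proof.
move=> AB; case: m => [|m]; rewrite ?addn0 ?addn1 //.
apply: prelie_local => //; elim: m => [|m IH] //=.
by apply: agreeW (prelie_local AB IH).
Qed.

Let step (X : tree_series) : tree_series := fun u =>
  tree_unit u -
  \sum_(2 <= m < (nleaves u).+1) (-1) ^+ m.+1 / m`!%:R * prelie_pow X m.-1 u.

Let step_local n A B : agree n A B -> agree n.+1 (step A) (step B).
Proof.
move=> AB u un; congr (_ - _); apply: eq_big_nat => -[|[|m]] // _.
by rewrite (prelie_pow_local (m := m.+1) AB) //= addn1.
Qed.

Let equation_step X : eulerian_equation X <-> forall u, X u = step X u.
Proof.
have E u : \sum_(1 <= m < (nleaves u).+1)
    (-1) ^+ m.+1 / m`!%:R * prelie_pow X m.-1 u = X u + (tree_unit u - step X u).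
  rewrite big_ltn ?ltnS ?nleaves_gt0 // expr2 mulrNN mulr1 divr1 mul1r.
  by rewrite /step opprB [tree_unit u + _]addrC subrK.
split=> H u.
  have := H u; rewrite E addrCA => /(canRL (addKr _)).
  by rewrite addNr => /eqP; rewrite subr_eq0 => /eqP.
by rewrite E {1}H addrCA subrr addr0.
Qed.

Lemma eulerian_exists_unique : exists! X : tree_series, eulerian_equation X.
Proof.
pose Y n := iter n step tree_unit.
have Yn n : agree n (Y n) (step (Y n)).
  by elim: n => [//|n IH]; apply: step_local.
have Ym n m : agree n (Y n) (Y (n + m)%N).
  elim: m => [|m IH]; first by rewrite addn0.
  move=> t tn; rewrite IH // addnS; apply: (Yn (n + m)%N).
  by apply: leq_trans tn _; rewrite leq_addr.
pose X t := Y (nleaves t).+1 t.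
have XY n : agree n X (Y n).
  move=> t tn; rewrite /X (Ym (nleaves t).+1 (n - (nleaves t).+1)%N) ?subnKC //.
exists X; split.
  apply/equation_step => u; rewrite {1}/X Yn //.
  by apply: (@step_local (nleaves u)) => // t tu; rewrite (XY (nleaves u).+1) // ltnW.
move=> Z /equation_step ZE; apply/funext.
have XZ n : agree n (Y n) Z.
  by elim: n => [//|n IH] t tn; rewrite ZE; apply: (step_local IH).
by move=> t; rewrite (XY (nleaves t).+1) // XZ.
Qed.

Lemma eulerianP : eulerian_equation eulerian.
Proof. by have [X [EX _]] := eulerian_exists_unique; exact: (xgetI _ EX). Qed.

Lemma eulerian_unique X : eulerian_equation X -> X = eulerian.
Proof.
have [Y [_ uY]] := eulerian_exists_unique => EX.
by rewrite -(uY _ EX) (uY _ eulerianP).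
Qed.

End TreeSeries.

(** * Leaf labelings *)

(* A labeling is the list w of the labels of the leaves, from left to right.
   The leaves descending from an inner vertex are consecutive. *)
Fixpoint admissible (t : pbtree) (w : seq nat) : bool :=
  if t is Node a b then
    [&& all (fun c => (head 0 w <= c <= last 0 w)%N) w,
        admissible a (take (nleaves a) w) & admissible b (drop (nleaves a) w)]
  else true.

Definition left_below_right (t : pbtree) (w : seq nat) : bool :=
  all (fun p => all (fun q =>
      left_pointing p.1 && right_pointing q.1 ==> (p.2 < q.2)%N)
    (zip (leaves t) w)) (zip (leaves t) w).

Definition nlabelings (t : pbtree) : nat :=
  count (fun w => admissible t w && left_below_right t w)
        (permutations (iota 1 (nleaves t))).

(** * Pro-nilpotent Lie algebras *)

Section Lie.
Variables (k : fieldType) (g : lmodType k).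

Record lie_bracket (br : g -> g -> g) : Prop := LieBracket {
  lie_linearl : forall a u v w, br (a *: u + v) w = a *: br u w + br v w;
  lie_linearr : forall a u v w, br w (a *: u + v) = a *: br w u + br w v;
  lie_alternating : forall u, br u u = 0;
  lie_jacobi : forall u v w, br u (br v w) + br v (br w u) + br w (br u v) = 0
}.

Record lie_ideal (br : g -> g -> g) (I : set g) : Prop := LieIdeal {
  ideal0 : I 0;
  ideal_linear : forall a u v, I u -> I v -> I (a *: u + v);
  ideal_bracket : forall u v, I v -> I (br u v)
}.

(* g is the inverse limit of the nilpotent Lie algebras g / F j, for a family F
   of ideals directed by reverse inclusion (for instance a complete descending
   filtration with [F i, F j] included in F (i + j)). Nilpotency of g / F j
   says that all sufficiently long iterated brackets [s1, [s2, ... [sn, v]]]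
   lie in F j. *)
Record pronilpotent (br : g -> g -> g) (J : Type) (F : J -> set g) : Prop :=
  Pronilpotent {
  pro_ideal : forall j, lie_ideal br (F j);
  pro_directed : forall i j, exists l, (F l `<=` F i `&` F j)%classic;
  pro_nilpotent : forall j, exists n : nat, forall (s : seq g) v,
    size s = n -> F j (foldr br v s);
  pro_separated : forall v, (forall j, F j v) -> v = 0;
  pro_complete : forall u : J -> g,
    (forall i j, (F i `<=` F j)%classic -> F j (u i - u j)) ->
    exists v, forall j, F j (u j - v)
}.

(* Unordered convergence of the family f to v, in the topology in which the
   F j form a basis of neighbourhoods of 0. *)
Definition sums_to (J : Type) (F : J -> set g) (I : eqType) (f : I -> g) (v : g) :=
  forall j, exists s : seq I, forall s' : seq I,
    uniq s' -> {subset s <= s'} -> F j (\sum_(i <- s') f i - v).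

(* Lie polynomials in two variables, false for the first and true for the
   second one, and their evaluation. *)
Inductive lie_poly : Type :=
  | LieVar of bool
  | LieAdd of lie_poly & lie_poly
  | LieScale of k & lie_poly
  | LieBr of lie_poly & lie_poly.

End Lie.

Fixpoint lie_eval (k : fieldType) (g : lmodType k) (br : g -> g -> g) (x y : g)
    (P : lie_poly k) : g :=
  match P with
  | LieVar b => if b then y else x
  | LieAdd P Q => lie_eval br x y P + lie_eval br x y Q
  | LieScale a P => a *: lie_eval br x y P
  | LieBr P Q => br (lie_eval br x y P) (lie_eval br x y Q)
  end.

(** * The Baker-Campbell-Hausdorff product *)

Section NcSeries.
Variable k : fieldType.

(* Formal power series in two noncommuting variables: f w is the coefficient
   of the word w. *)
Definition ncseries : lmodType k := (seq bool -> k^o)%type.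

Definition nc_var (b : bool) : ncseries := fun w => (w == [:: b])%:R.
Definition nc_one : ncseries := fun w => (w == [::])%:R.
Definition nc_mul (f h : ncseries) : ncseries := fun w =>
  \sum_(i < (size w).+1) f (take i w) * h (drop i w).
Definition nc_pow (f : ncseries) (n : nat) : ncseries := iter n (nc_mul f) nc_one.
Definition nc_comm (f h : ncseries) : ncseries := nc_mul f h - nc_mul h f.

(* For f without constant term, f ^ n has no term of length less than n; this
   is why the sums below may stop at the length of w. *)
Definition nc_exp (f : ncseries) : ncseries := fun w =>
  \sum_(0 <= n < (size w).+1) n`!%:R^-1 * nc_pow f n w.
(* log (1 + f) *)
Definition nc_log1 (f : ncseries) : ncseries := fun w =>
  \sum_(1 <= n < (size w).+1) (-1) ^+ n.+1 / n%:R * nc_pow f n w.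

(* log (e^X e^Y) *)
Definition nc_bch : ncseries :=
  nc_log1 (nc_mul (nc_exp (nc_var false)) (nc_exp (nc_var true)) - nc_one).

Definition nc_homogeneous_part (n : nat) (f : ncseries) : ncseries :=
  fun w => if size w == n then f w else 0.

End NcSeries.

Section BCH.
Variables (k : fieldType) (g : lmodType k) (br : g -> g -> g).
Variables (J : Type) (F : J -> set g).

(* z is the value at (x, y) of the series log (e^X e^Y), each homogeneous part
   of which is a Lie polynomial in X and Y. *)
Definition bch_value (x y z : g) : Prop :=
  exists P : nat -> lie_poly k,
    (forall n, lie_eval (@nc_comm k) (nc_var k false) (nc_var k true) (P n)
               = nc_homogeneous_part n (nc_bch k)) /\
    sums_to F (fun n => lie_eval br x y (P n)) z.

(* In characteristic 0, and for a pro-nilpotent g, there is exactly one z with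
   bch_value x y z, since the free Lie algebra embeds into the free associative
   algebra. *)
Definition bch (x y : g) : g := xget 0 [set z | bch_value x y z].

Fixpoint tree_bracket_rec (dir : bool) (t : pbtree) (x y : g) : g :=
  if t is Node a b then
    br (tree_bracket_rec false a x y) (tree_bracket_rec true b x y)
  else if dir then y else x.

Definition tree_bracket (t : pbtree) (x y : g) : g :=
  if t is Leaf then x + y else tree_bracket_rec true t x y.

End BCH.

(* Main.v *)
Require Import Defs.
From HB Require Import structures.
From mathcomp Require Import all_boot all_order all_algebra.
From mathcomp Require Import ring.
From mathcomp Require Import boolp classical_sets functions.

(** Write X and Y for the two variables, [delta b] for the derivation of the
    algebra of noncommutative series that multiplies a word by its number of
    letters [b] ([false] is X, [true] is Y), and phi(T) for
    K_T / (l_T! r_T!) T(X,Y). Counting labelings gives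
    K_[a,b] = C(l - 1, l_a - 1) C(r - 1, r_b - 1) K_a K_b, which says that
    delta_X delta_Y phi([a,b]) = [delta_X phi(a), delta_Y phi(b)]. By induction
    on t, this and the Jacobi identity yield
      delta_Y phi(s |> t) = [phi(s), delta_Y phi(t)].
    Hence for Z = phi(sum_T E_T T) the equation defining the Eulerian
    coefficients becomes
      sum_(m >= 0) (-1)^m / (m+1)! ad_Z^m (delta_Y Z) = Y,
    whose left-hand side is e^-Z (delta_Y e^Z). So e^Z solves the linear
    equation delta_Y W = W Y with X-part e^X, as e^X e^Y does, and
    Z = log (e^X e^Y).
    The identity is transported to g by the Dynkin operator with values in g:
    a Lie polynomial that vanishes as a noncommutative series vanishes at every
    pair of elements of g. *)

Set Implicit Arguments.
Unset Strict Implicit.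
Unset Printing Implicit Defensive.

Import GRing.Theory.
Local Open Scope ring_scope.

(** * The algebra of noncommutative power series *)

(** A separate type for the series, on which the concatenation product [nc_mul] serves as ring
    multiplication. *)
Definition ncalg (k : fieldType) : Type := seq bool -> k.
HB.instance Definition _ (k : fieldType) := GRing.Lmodule.copy (ncalg k) (ncseries k).

Section NcAlgebra.
Variable k : fieldType.
Implicit Types (f g h : ncalg k) (a : k) (w : seq bool).

(** Left quotient by a letter; [shift_mul] is the rule that drives inductions on the word, first
    letter first. *)
Definition shift (b : bool) f : ncalg k := fun w => f (b :: w).

Lemma nc_addE f h w : (f + h) w = f w + h w. Proof. by []. Qed.
Lemma nc_subE f h w : (f - h) w = f w - h w. Proof. by []. Qed.
Lemma nc_scaleE a f w : (a *: f) w = a * f w. Proof. by []. Qed.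
Lemma nc_zeroE w : (0 : ncalg k) w = 0. Proof. by []. Qed.
Lemma nc_sumE I (r : seq I) (P : pred I) (F : I -> ncalg k) w :
  (\sum_(i <- r | P i) F i) w = \sum_(i <- r | P i) F i w.
Proof. by apply: (big_morph (fun f : ncalg k => f w)). Qed.

Lemma nc_mul0 f h : nc_mul f h [::] = f [::] * h [::].
Proof. by rewrite /nc_mul big_ord1. Qed.

Lemma nc_mul_cons f h b w :
  nc_mul f h (b :: w) = f [::] * h (b :: w) + nc_mul (shift b f) h w.
Proof. by rewrite /nc_mul big_ord_recl. Qed.

Lemma nc_mulDl : left_distributive (@nc_mul k : ncalg k -> ncalg k -> ncalg k) +%R.
Proof.
move=> f g h; apply/funext => w; rewrite nc_addE /nc_mul -big_split /=.
by apply: eq_bigr => i _; rewrite nc_addE mulrDl.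
Qed.

Lemma nc_mulDr : right_distributive (@nc_mul k : ncalg k -> ncalg k -> ncalg k) +%R.
Proof.
move=> f g h; apply/funext => w; rewrite nc_addE /nc_mul -big_split /=.
by apply: eq_bigr => i _; rewrite nc_addE mulrDr.
Qed.

Lemma nc_scaleAl a f h : a *: (nc_mul f h : ncalg k) = nc_mul (a *: f) h.
Proof.
apply/funext => w; rewrite nc_scaleE /nc_mul mulr_sumr.
by apply: eq_bigr => i _; rewrite nc_scaleE mulrA.
Qed.

Lemma nc_scaleAr a f h : a *: (nc_mul f h : ncalg k) = nc_mul f (a *: h).
Proof.
apply/funext => w; rewrite nc_scaleE /nc_mul mulr_sumr.
by apply: eq_bigr => i _; rewrite nc_scaleE mulrCA.
Qed.

Lemma shift_mul b f h :
  shift b (nc_mul f h) = (f [::] *: shift b h + (nc_mul (shift b f) h : ncalg k)).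
Proof. by apply/funext => w; rewrite /shift nc_mul_cons. Qed.

Lemma nc_mulA : associative (@nc_mul k : ncalg k -> ncalg k -> ncalg k).
Proof.
move=> f g h; apply/funext => w; elim: w f => [|b w IH] f.
  by rewrite !nc_mul0 mulrA.
rewrite !nc_mul_cons shift_mul nc_mulDl -nc_scaleAl nc_addE nc_scaleE -IH.
by rewrite nc_mul0 mulrDr !mulrA addrA.
Qed.

Lemma nc_mul0l w h : nc_mul (0 : ncalg k) h w = 0.
Proof. by rewrite /nc_mul big1 // => i _; rewrite mul0r. Qed.

Lemma nc_mul1l : left_id (@nc_one k : ncalg k) (@nc_mul k : ncalg k -> ncalg k -> ncalg k).
Proof.
move=> f; apply/funext => -[|b w]; first by rewrite nc_mul0 /nc_one mul1r.
rewrite nc_mul_cons /nc_one eqxx mul1r -[RHS]addr0; congr (_ + _).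
exact: nc_mul0l.
Qed.

Lemma nc_mul1r : right_id (@nc_one k : ncalg k) (@nc_mul k : ncalg k -> ncalg k -> ncalg k).
Proof.
move=> f; apply/funext => w; elim: w f => [|b w IH] f.
  by rewrite nc_mul0 /nc_one mulr1.
by rewrite nc_mul_cons IH /nc_one /= mulr0 add0r.
Qed.

Lemma nc_one_neq0 : (@nc_one k : ncalg k) != 0.
Proof.
by apply/eqP => /(congr1 (fun f : ncalg k => f [::])) /eqP; rewrite oner_eq0.
Qed.

End NcAlgebra.

HB.instance Definition _ (k : fieldType) := GRing.Zmodule_isNzRing.Build (ncalg k)
  (@nc_mulA k) (@nc_mul1l k) (@nc_mul1r k) (@nc_mulDl k) (@nc_mulDr k) (@nc_one_neq0 k).
HB.instance Definition _ (k : fieldType) :=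
  GRing.Lmodule_isLalgebra.Build k (ncalg k) (@nc_scaleAl k).
HB.instance Definition _ (k : fieldType) :=
  GRing.Lalgebra_isAlgebra.Build k (ncalg k) (@nc_scaleAr k).

(** * Truncation, the length filtration, powers of ad and the derivations [delta] *)

Section NcCalculus.
Variable k : fieldType.
Implicit Types (f g h z : ncalg k) (a : k) (w : seq bool).

Lemma nc_mulE f h : nc_mul f h = f * h. Proof. by []. Qed.
Lemma nc_powE f n : nc_pow f n = f ^+ n.
Proof. by elim: n => //= n IH; rewrite exprS -IH. Qed.

Definition agree_upto n f h := forall w, (size w <= n)%N -> f w = h w.

Lemma agree_uptoM n f f' h h' :
  agree_upto n f f' -> agree_upto n h h' -> agree_upto n (f * h) (f' * h').
Proof.
move=> ff hh w wn; rewrite -!nc_mulE /nc_mul; apply: eq_bigr => i _.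
have iw : (i <= size w)%N by rewrite -ltnS.
rewrite ff ?hh // (leq_trans _ wn) //; first by rewrite size_drop leq_subr.
by rewrite size_take; case: ltnP => // _; apply: leq_trans iw _.
Qed.

Lemma agree_uptoX n f f' i : agree_upto n f f' -> agree_upto n (f ^+ i) (f' ^+ i).
Proof. by move=> ff; elim: i => // i IH; rewrite !exprS; apply: agree_uptoM. Qed.

Definition order_ge n f := forall w, (size w < n)%N -> f w = 0.

Lemma order_geM m n f h : order_ge m f -> order_ge n h -> order_ge (m + n) (f * h).
Proof.
move=> fm hn w wmn; rewrite -nc_mulE /nc_mul big1 // => i _.
have iw : (i <= size w)%N by rewrite -ltnS.
case: (ltnP i m) => im; first by rewrite fm ?mul0r // size_takel.
rewrite hn ?mulr0 // size_drop ltn_subLR //.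
by apply: leq_trans wmn _; rewrite leq_add2r.
Qed.

Lemma order_geX n f : order_ge 1 f -> order_ge n (f ^+ n).
Proof. by move=> f1; elim: n => [//|n IH]; rewrite exprS -add1n; apply: order_geM. Qed.

Lemma order_geB n f h : order_ge n f -> order_ge n h -> order_ge n (f - h).
Proof. by move=> fn hn w wn; rewrite nc_subE fn // hn // subrr. Qed.

Definition adn z (m : nat) f : ncalg k := iter m (fun h => z * h - h * z) f.

Lemma order_ge_adn z m n f : order_ge 1 z -> order_ge n f -> order_ge (m + n) (adn z m f).
Proof.
move=> z1 fn; elim: m => [//|m IH] /=; apply: order_geB.
  by rewrite addSn -add1n; apply: order_geM.
by rewrite addSn -addn1; apply: order_geM.
Qed.

Definition delta (b : bool) f : ncalg k := fun w => (count_mem b w)%:R * f w.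

Lemma delta_is_linear b : linear (delta b).
Proof.
move=> a f h; apply/funext => w.
by rewrite /delta !(nc_addE, nc_scaleE) mulrDr mulrCA.
Qed.
HB.instance Definition _ b := GRing.isLinear.Build k (ncalg k) (ncalg k) *:%R (delta b)
  (delta_is_linear b).

Lemma deltaM b f h : delta b (f * h) = delta b f * h + f * delta b h.
Proof.
apply/funext => w; rewrite nc_addE /delta -!nc_mulE /nc_mul mulr_sumr -big_split /=.
apply: eq_bigr => i _; rewrite -[in count_mem b w](cat_take_drop i w) count_cat natrD.
by rewrite mulrDl mulrA; congr (_ + _); rewrite mulrCA.
Qed.

Lemma delta_one b : delta b 1 = 0.
Proof.
apply/funext => -[|c w]; rewrite /delta /= ?mul0r //.
by rewrite [X in _ * X](_ : _ = 0) // mulr0.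
Qed.

Lemma deltaC b c f : delta b (delta c f) = delta c (delta b f).
Proof. by apply/funext => w; rewrite /delta mulrCA. Qed.

Lemma order_ge_delta b n f : order_ge n f -> order_ge n (delta b f).
Proof. by move=> fn w wn; rewrite /delta fn // mulr0. Qed.

(** Right multiplication by [z] is left multiplication by [z] minus ad z, and these two operators
    commute; this is the binomial theorem for the n-th power of their difference. *)
Lemma mul_expr_adn z f n :
  f * z ^+ n = \sum_(m < n.+1) ((-1) ^+ m *+ 'C(n, m)) *: (z ^+ (n - m) * adn z m f).
Proof.
elim: n f => [|n IH] f; first by rewrite big_ord1 bin0 mulr1n scale1r mul1r expr0 mulr1.
have -> : f * z ^+ n.+1 = z * (f * z ^+ n) - (z * f - f * z) * z ^+ n.
  by rewrite exprS mulrBl !mulrA opprB addrC subrK.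
rewrite (IH f) (IH (z * f - f * z)) big_ord_recl.
rewrite [X in _ - X]big_ord_recr [RHS]big_ord_recl [X in _ = _ + X]big_ord_recr /=.
rewrite mulrDr mulr_sumr !bin0 !subn0 -scalerAr mulrA -exprS opprD.
rewrite -addrA (addrA _ (- _) (- _)) -sumrB; congr (_ + (_ + _)).
  apply: eq_bigr => i _; rewrite /bump !add1n binS /= subSS -scalerAr mulrA -exprS.
  rewrite -subSn // subSS /adn -iterSr mulrnDr scalerDl exprS mulN1r; congr (_ + _).
  by rewrite mulNrn scaleNr.
rewrite /bump !add1n !binn subnn subnn !mulr1n exprS mulN1r scaleNr.
by rewrite /adn -iterSr.
Qed.

(* Obtained by moving delta z to the right in each z ^+ i * delta b z * z ^+ j. *)
Lemma deltaX b z n : delta b (z ^+ n) =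
  \sum_(m < n) ((-1) ^+ m *+ 'C(n, m.+1)) *: (z ^+ (n.-1 - m) * adn z m (delta b z)).
Proof.
elim: n => [|n IH]; first by rewrite big_ord0 delta_one.
rewrite exprS deltaM IH (mul_expr_adn z (delta b z) n) /= addrC [RHS]big_ord_recr /=.
rewrite [in X in _ + X]big_ord_recr /= addrA !binn; congr (_ + _).
rewrite mulr_sumr -big_split /=; apply: eq_bigr => i _.
rewrite binS mulrnDr scalerDl -scalerAr mulrA -exprS.
suff -> : (n.-1 - i).+1 = (n - i)%N by [].
by case: n {IH} i => [[]|n] // i; rewrite subSn // -ltnS.
Qed.

End NcCalculus.

(** * Logarithm and exponential *)

Section LogExp.
Variable k : fieldType.
Hypothesis char0 : [pchar k] =i pred0.
Implicit Types (f g h y z : ncalg k) (a : k) (w : seq bool).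

Lemma natf_neq0_char0 n : (0 < n)%N -> n%:R != 0 :> k.
Proof. by move=> n0; rewrite ((pcharf0P k).1 char0) -lt0n. Qed.

Lemma factf_neq0_char0 n : n`!%:R != 0 :> k.
Proof. exact/natf_neq0_char0/fact_gt0. Qed.

(** Truncations of exp and log (1 + T) in one variable. That log inverts exp is proved for these
    commutative polynomials and then transferred by substituting a series. *)
Definition exp_poly n : {poly k} := \sum_(i < n.+1) i`!%:R^-1 *: 'X^i.
Definition log1_poly n : {poly k} := \sum_(i < n) ((-1) ^+ i / i.+1%:R) *: 'X^(i.+1).

Lemma deriv_exp_poly n : (exp_poly n.+1)^`() = exp_poly n.
Proof.
rewrite /exp_poly big_ord_recl derivD raddf_sum derivZ derivXn.
rewrite mulr0n scaler0 add0r; apply: eq_bigr => i _ /=.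
rewrite derivZ derivXn /bump add1n /= -scaler_nat scalerA factS natrM invfM mulrC.
by rewrite mulVKf // natf_neq0_char0.
Qed.

Lemma deriv_log1_poly n : (log1_poly n)^`() * (1 + 'X) = 1 - (- 'X) ^+ n.
Proof.
rewrite -{2}(expr1n _ n) subrXX opprK mulrC; congr (_ * _).
rewrite raddf_sum; apply: eq_bigr => i _ /=.
rewrite derivZ derivXn /= -scaler_nat scalerA divfK ?natf_neq0_char0 //.
by rewrite expr1n mul1r -[- 'X]scaleN1r exprZn.
Qed.

(** In characteristic zero, every coefficient of positive degree is recovered from the derivative by
    dividing by that degree. *)
Lemma dvdp_Xn_deriv (p : {poly k}) n :
  p`_0 = 0 -> 'X^n %| p^`() -> 'X^(n.+1) %| p.
Proof.
move=> p0 pn; have co i : (i < n.+1)%N -> p`_i = 0.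
  case: i => [//|i] lin; have [q pq] := dvdpP _ _ pn.
  have := coef_deriv p i; rewrite pq coefMXn -ltnS lin => /esym/eqP.
  by rewrite -mulr_natr mulf_eq0 (negPf (natf_neq0_char0 _)) // orbF => /eqP.
apply/dvdpP; exists (drop_poly n.+1 p).
rewrite -[LHS](poly_take_drop n.+1) addrC (_ : take_poly _ _ = 0) ?addr0 //.
by apply/polyP => i; rewrite coef_take_poly coef0; case: ltnP => // /co.
Qed.

Lemma horner0_exp_poly n : (exp_poly n)`_0 = 1.
Proof.
rewrite /exp_poly big_ord_recl coefD expr0 coefZ coefC eqxx fact0 invr1 mulr1.
by rewrite coef_sum big1 ?addr0 // => i _; rewrite coefZ coefXn mulr0.
Qed.

(** The constant term vanishes, so it suffices to differentiate. With E the truncated exponential,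
    E' is E minus its last term, and log1'(E - 1) E is 1 up to a power of 1 - E; both errors are
    divisible by the required power of X, since X divides E - 1. *)
Lemma log1_exp_poly n : 'X^(n.+1) %| (log1_poly n \Po (exp_poly n - 1)) - 'X.
Proof.
case: n => [|n].
  by rewrite /log1_poly big_ord0 comp_poly0 sub0r dvdpNr.
have Xdv : 'X %| exp_poly n.+1 - 1.
  rewrite -(subr0 'X) dvdp_XsubCl rootE horner_coef0 coefB horner0_exp_poly.
  by rewrite coefC subrr.
apply: dvdp_Xn_deriv.
  rewrite coefB coefX subr0 -horner_coef0 horner_comp hornerD hornerN hornerC.
  rewrite horner_coef0 horner0_exp_poly subrr /log1_poly horner_sum big1 // => i _.
  by rewrite hornerZ hornerXn expr0n mulr0.
rewrite derivB derivX deriv_comp derivB -polyC1 derivC subr0 polyC1 deriv_exp_poly.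
have /(canRL (addrK _))-> : exp_poly n + n.+1`!%:R^-1 *: 'X^(n.+1) = exp_poly n.+1.
  by rewrite /exp_poly [RHS]big_ord_recr.
rewrite mulrBr; have := congr1 (comp_poly (exp_poly n.+1 - 1)) (deriv_log1_poly n.+1).
rewrite comp_polyM comp_polyD comp_polyB !comp_polyC comp_polyX (addrC 1) subrK => ->.
rewrite rmorphXn raddfN /= comp_polyX polyC1 (addrC 1) addrAC addrK -opprD dvdpNr.
rewrite dvdp_add ?dvdp_exp2r ?dvdpNr // dvdp_mull // dvdpZr //.

by rewrite invr_eq0; exact: factf_neq0_char0.
Qed.

Lemma horner_alg_exp_poly z n :
  horner_alg z (exp_poly n) = \sum_(i < n.+1) i`!%:R^-1 *: z ^+ i.
Proof.
rewrite linear_sum; apply: eq_bigr => i _ /=.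
by rewrite linearZ /= rmorphXn /= horner_algX mulr_algl.
Qed.

Lemma horner_alg_log1_poly z n :
  horner_alg z (log1_poly n) = \sum_(i < n) ((-1) ^+ i / i.+1%:R) *: z ^+ i.+1.
Proof.
rewrite linear_sum; apply: eq_bigr => i _ /=.
by rewrite linearZ /= rmorphXn /= horner_algX mulr_algl.
Qed.

Lemma nc_exp_agree z n : order_ge 1 z ->
  agree_upto n (nc_exp z) (\sum_(i < n.+1) i`!%:R^-1 *: z ^+ i).
Proof.
move=> z1 w wn; rewrite nc_sumE -(big_mkord xpredT (fun i => (i`!%:R^-1 *: z ^+ i) w)).
rewrite /nc_exp (@big_cat_nat _ _ _ (size w).+1 0 n.+1) //= [X in _ = _ + X]big_nat [X in _ = _ + X]big1 ?addr0.
  by apply: eq_bigr => i _; rewrite nc_powE nc_scaleE.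
by move=> i /andP[wi _]; rewrite nc_scaleE (order_geX (n := i) z1) ?mulr0.
Qed.

(** A coefficient at a word of length n only sees truncations of order n. These are values of
    polynomials at [z], where [log1_exp_poly] applies; its error term is a multiple of [z ^+ n.+1]
    and has no word of length n. *)
Lemma nc_log1_exp z : order_ge 1 z -> nc_log1 (nc_exp z - nc_one k : ncalg k) = z.
Proof.
move=> z1; apply/funext => w; set n := size w; set f : ncalg k := _ - _.
have -> : nc_log1 f w = horner_alg f (log1_poly n) w.
  rewrite horner_alg_log1_poly nc_sumE /nc_log1 big_add1 /= big_mkord.
  by apply: eq_bigr => i _; rewrite nc_powE nc_scaleE !exprS !mulN1r opprK.
pose e := horner_alg z (exp_poly n - 1).
have fe : agree_upto n f e.
  move=> v vn; rewrite /f /e linearB /= horner_alg_exp_poly rmorph1 !nc_subE.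
  by rewrite (nc_exp_agree z1 vn).
have -> : horner_alg f (log1_poly n) w = horner_alg e (log1_poly n) w.
  rewrite !horner_alg_log1_poly !nc_sumE; apply: eq_bigr => i _.
  by rewrite !nc_scaleE (agree_uptoX _ fe).
have -> : horner_alg e (log1_poly n) = horner_alg z (log1_poly n \Po (exp_poly n - 1)).
  rewrite horner_alg_log1_poly [log1_poly _ \Po _]raddf_sum raddf_sum /=.
  by apply: eq_bigr => i _; rewrite comp_polyZ linearZ /= comp_Xn_poly rmorphXn /= mulr_algl.
have /dvdpP[q /(canRL (subrK _))->] := log1_exp_poly n.
rewrite rmorphD rmorphM rmorphXn /= horner_algX nc_addE.
by rewrite (order_geM (m := 0) (n := n.+1) _ (order_geX z1)) ?add0r.
Qed.

End LogExp.

(** * The derivative of the exponential *)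

Section DeltaExp.
Variable k : fieldType.
Hypothesis char0 : [pchar k] =i pred0.
Implicit Types (f g h y z : ncalg k) (a : k) (w : seq bool).

Definition mexp z : ncalg k := nc_exp z.
Definition xvar b : ncalg k := nc_var k b.

Lemma order_ge_xvar b : order_ge 1 (xvar b).
Proof. by case. Qed.

Lemma delta_xvar b c : delta b (xvar c) = if b == c then xvar c else 0.
Proof.
apply/funext => w; rewrite /delta /xvar /nc_var.
have [->|wc] := eqVneq w [:: c].
  by rewrite /= addn0 eq_sym mulr1; case: eqP => //; rewrite eqxx.
by rewrite mulr0; case: ifP => // _; rewrite (negPf wc).
Qed.

Lemma delta_sumE b w I (r : seq I) (c : I -> k) (F : I -> ncalg k) :
  delta b (\sum_(i <- r) c i *: F i) w = \sum_(i <- r) c i * delta b (F i) w.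
Proof.
by rewrite linear_sum nc_sumE; apply: eq_bigr => i _; rewrite linearZ.
Qed.

(* The truncated form of e^-z (delta e^z) = sum_m (-1)^m / (m+1)! ad_z^m (delta z). *)
Lemma delta_mexp b z y : order_ge 1 z ->
  (forall w, \sum_(m < size w) ((-1) ^+ m / m.+1`!%:R) * adn z m (delta b z) w = y w) ->
  delta b (mexp z) = mexp z * y.
Proof.
move=> z1 zy; apply/funext => w; set n := size w.
(* [G i m] is the contribution of the i-th term of e^z and the m-th term of the series for [y]; both
   sides will be its sum over i + m < n. *)
pose G i m := ((-1) ^+ m / (i`! * m.+1`!)%:R) * (z ^+ i * adn z m (delta b z)) w.
have dz1 := order_ge_delta b z1.
have G0 i m : (n <= i + m)%N -> G i m = 0.
  move=> nim; rewrite /G (order_geM (m := i) (n := m + 1)) ?mulr0 //.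
  - exact: order_geX.
  - exact: order_ge_adn.
  - by rewrite addnA addn1 ltnS.
have yn : agree_upto n y
    (\sum_(m < n) ((-1) ^+ m / m.+1`!%:R) *: adn z m (delta b z)).
  move=> v vn; rewrite -zy nc_sumE.
  rewrite -(big_mkord xpredT (fun m => ((-1) ^+ m / m.+1`!%:R) * adn z m (delta b z) v)).
  rewrite -(big_mkord xpredT (fun m => (((-1) ^+ m / m.+1`!%:R) *: adn z m (delta b z)) v)).
  rewrite [RHS](@big_cat_nat _ _ _ (size v)) //= [X in _ = _ + X]big_nat.
  rewrite [X in _ = _ + X]big1 ?addr0 // => i /andP[vi _].
  by rewrite nc_scaleE (order_ge_adn (m := i) z1 dz1) ?mulr0 // addn1 ltnS.
have Ew := agree_uptoM (nc_exp_agree (n := n) z1 : agree_upto n (mexp z) _) yn (leqnn n).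
rewrite Ew.
rewrite /delta /mexp.
rewrite (nc_exp_agree (n := n) z1) // -[LHS]/(delta b _ w) delta_sumE.
transitivity (\sum_(m < n) \sum_(0 <= i < n - m) G i m).
  rewrite big_ord_recl delta_one mulr0 add0r.
  (* This is [deltaX] for z^(i+1) / (i+1)!, using C(i+1, m+1) / (i+1)! = 1 / ((i-m)! (m+1)!). *)
  transitivity (\sum_(i < n) \sum_(m < n | (m <= i)%N) G (i - m)%N m).
    apply: eq_bigr => i _; rewrite lift0 deltaX nc_sumE mulr_sumr /=.
    rewrite (big_ord_widen_cond n xpredT (fun m => i.+1`!%:R^-1 *
       (((-1) ^+ m *+ 'C(i.+1, m.+1)) *: (z ^+ (i - m) * adn z m (delta b z))) w)) //=.
    apply: eq_bigr => m mi; rewrite /G nc_scaleE mulrA; congr (_ * _).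
    rewrite -[_ *+ 'C(_, _)]mulr_natr mulrCA; congr (_ * _).
    have /(congr1 (fun n => n%:R : k)) := bin_fact (m := m.+1) (n := i.+1) mi.
    rewrite subSS natrM mulnC => <-.
    by rewrite invfM mulrAC mulVf ?mul1r // natf_neq0_char0 // bin_gt0.
  rewrite (exchange_big_dep xpredT) //=; apply: eq_bigr => m _.
  rewrite -(big_mkord (fun i => (m <= i)%N) (fun i => G (i - m)%N m)).
  rewrite -(big_nat_widenl m 0 n xpredT) // -{1}(add0n (val m)) big_addn.
  by apply: eq_bigr => i _; rewrite addnK.
rewrite mulr_sumr nc_sumE; apply: eq_bigr => m _.
rewrite mulr_suml nc_sumE -(big_mkord xpredT (fun i => (i`!%:R^-1 *: z ^+ i *
  (((-1) ^+ m / m.+1`!%:R) *: adn z m (delta b z)) : ncalg k) w)).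
rewrite [RHS](@big_cat_nat _ _ _ (n - m)) //=; last by rewrite leqW ?leq_subr.
have E i : (i`!%:R^-1 *: z ^+ i *
    (((-1) ^+ m / m.+1`!%:R) *: adn z m (delta b z)) : ncalg k) w = G i m.
  by rewrite -scalerAl -scalerAr scalerA nc_scaleE /G natrM invfM mulrCA.
rewrite [X in _ = _ + X]big_nat [X in _ = _ + X]big1 ?addr0 => [|i /andP[mi _]].
  by apply: eq_bigr => i _; rewrite E.
by rewrite E G0 // addnC -leq_subLR.
Qed.

Lemma mexp_xvar b : delta b (mexp (xvar b)) = mexp (xvar b) * xvar b.
Proof.
apply: delta_mexp => [|w]; first exact: order_ge_xvar.
rewrite delta_xvar eqxx; have a0 m : adn (xvar b) m.+1 (xvar b) = 0.
  elim: m => [|m IH]; first by rewrite /adn /= subrr.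
  by rewrite /adn iterS -/(adn _ m.+1 _) IH mulr0 mul0r subrr.
case: w => [|c w]; first by rewrite big_ord0 order_ge_xvar.
rewrite big_ord_recl big1 ?addr0 => [|i _]; last by rewrite lift0 a0 nc_zeroE mulr0.
by rewrite divr1 mul1r.
Qed.

Lemma mexp_xvar_neq b c : b != c -> delta b (mexp (xvar c)) = 0.
Proof.
move=> bc; rewrite -[RHS](mulr0 (mexp (xvar c))); apply: delta_mexp.
  exact: order_ge_xvar.
move=> w; rewrite delta_xvar (negPf bc); have a0 m : adn (xvar c) m 0 = 0.
  by elim: m => [//|m IH]; rewrite /adn iterS -/(adn _ m _) IH mulr0 mul0r subrr.
by rewrite big1 // => i _; rewrite a0 nc_zeroE mulr0.
Qed.

(** Equality after the letter [b] is set to 0; it plays the role of an initial condition for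
    equations in [delta b]. *)
Definition agree_without b f h := forall w, b \notin w -> f w = h w.

Lemma agree_withoutM b f f' h h' :
  agree_without b f f' -> agree_without b h h' -> agree_without b (f * h) (f' * h').
Proof.
move=> ff hh w bw; rewrite -!nc_mulE /nc_mul; apply: eq_bigr => i _.
rewrite ff ?hh //; apply: contra bw; [exact: mem_drop|exact: mem_take].
Qed.

Lemma agree_without_mexp b f h : agree_without b f h -> agree_without b (mexp f) (mexp h).
Proof.
move=> fh; have fhX i : agree_without b (f ^+ i) (h ^+ i).
  by elim: i => // i IH; rewrite !exprS; apply: agree_withoutM.
by move=> w bw; apply: eq_bigr => i _; rewrite !nc_powE fhX.
Qed.

Lemma mexp0 : mexp 0 = 1.
Proof.
apply/funext => w; rewrite /mexp /nc_exp big_nat_recl // big1 => [|i _].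
  by rewrite addr0 fact0 invr1 mul1r.
by rewrite nc_powE exprS mul0r nc_zeroE mulr0.
Qed.

(** Induction on length: at a word containing [b], the equation gives the coefficient, times the
    nonzero number of letters [b], in terms of coefficients of shorter words. *)
Lemma delta_mul_xvar_inj b f h : delta b f = f * xvar b -> delta b h = h * xvar b ->
  agree_without b f h -> f = h.
Proof.
move=> df dh fh; apply/funext => w; have [n] := ubnP (size w).
elim: n w => // n IH w /ltnSE wn; have [bw|/fh//] := boolP (b \in w).
have cw : (count_mem b w)%:R != 0 :> k by rewrite natf_neq0_char0 // -has_count has_pred1.
apply: (mulfI cw); rewrite -[LHS]/(delta b f w) -[RHS]/(delta b h w) df dh.
rewrite -!nc_mulE /nc_mul; apply: eq_bigr => i _.
have [iw|wi] := ltnP i (size w).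
  by rewrite IH // size_takel ?(leq_trans iw) // ltnW.
(* The whole word, as a prefix, is paired with the constant term of [xvar b], which is 0. *)
by rewrite drop_oversize // !order_ge_xvar ?mulr0.
Qed.

Lemma nc_bch_unique z : order_ge 1 z -> agree_without true z (xvar false) ->
  (forall w, \sum_(m < size w) ((-1) ^+ m / m.+1`!%:R) * adn z m (delta true z) w
             = xvar true w) ->
  nc_bch k = z.
Proof.
move=> z1 zX zY; suff E : mexp z = mexp (xvar false) * mexp (xvar true).
  by rewrite -[RHS](nc_log1_exp char0 z1) -/(mexp z) E.
apply: (@delta_mul_xvar_inj true).
- exact: delta_mexp.
- by rewrite deltaM mexp_xvar_neq // mul0r add0r mexp_xvar mulrA.
(* Modulo Y, [z] becomes X and e^Y becomes e^0; the factor [mexp 0], equal to 1, is inserted to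
   match the two products. *)
rewrite -[mexp z]mulr1 -mexp0; apply: agree_withoutM; apply: agree_without_mexp => //.
by move=> -[|c [|d w]] //; case: c.
Qed.

End DeltaExp.

(** * Evaluation of trees and of tree series *)

Fixpoint leaf_dirs (d : bool) (t : pbtree) : seq bool :=
  if t is Node a b then leaf_dirs false a ++ leaf_dirs true b else [:: d].

(* The number of leaves of t pointing in direction c ([true] for right) when the
   root edge points in direction d. *)
Definition ndir (c d : bool) (t : pbtree) : nat := count_mem c (leaf_dirs d t).

Lemma ndir_node c d a b : ndir c d (Node a b) = (ndir c false a + ndir c true b)%N.
Proof. exact: count_cat. Qed.

Lemma ndir_gt0 d t : (0 < ndir d d t)%N.
Proof.
elim: t d => [|a IHa b IHb] d; first by rewrite /ndir /= eqxx.
by case: d; rewrite ndir_node addn_gt0 ?IHa ?IHb ?orbT.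
Qed.

Lemma ndir_node_gt0 c d a b : (0 < ndir c d (Node a b))%N.
Proof. by rewrite ndir_node addn_gt0; case: c; rewrite ndir_gt0 ?orbT. Qed.

Lemma nleaves_graft_rec d s e t :
  nleaves (graft_rec d s e t) = (nleaves s + nleaves t)%N.
Proof.
elim: t d e => [|a IHa b IHb] d [|[] e] /=; try by case: d; rewrite //= addnC.
  by rewrite IHb addnCA.
by rewrite IHa addnA.
Qed.

Section TreeEvaluation.
Variable k : fieldType.
Hypothesis char0 : [pchar k] =i pred0.
Implicit Types (f g h y z : ncalg k) (w : seq bool) (s t : pbtree).

Local Notation delta := (@delta k).
Local Notation xvar := (@xvar k).

Definition cm f h := f * h - h * f.

Lemma cm_is_linear f : linear (cm f).
Proof.
by move=> c g h; rewrite /cm mulrDl mulrDr -scalerAl -scalerAr opprD addrACA scalerBr.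
Qed.
HB.instance Definition _ f :=
  GRing.isLinear.Build k (ncalg k) (ncalg k) *:%R (cm f) (cm_is_linear f).

Lemma cmN f h : - cm f h = cm h f.
Proof. by rewrite /cm opprB. Qed.

Lemma cmZr c f h : cm f (c *: h) = c *: cm f h.
Proof. exact: linearZ. Qed.

Lemma cmZl c f h : cm (c *: f) h = c *: cm f h.
Proof. by rewrite -cmN cmZr -scalerN cmN. Qed.

Lemma deltaZ c d f : delta d (c *: f) = c *: delta d f.
Proof. exact: linearZ. Qed.

Lemma delta_sum d I (r : seq I) (F : I -> ncalg k) (c : I -> k) :
  delta d (\sum_(i <- r) c i *: F i) = \sum_(i <- r) c i *: delta d (F i).
Proof. by rewrite raddf_sum; apply: eq_bigr => i _ /=; rewrite deltaZ. Qed.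

Lemma cm_sumr I (r : seq I) (F : I -> ncalg k) (c : I -> k) f :
  cm f (\sum_(i <- r) c i *: F i) = \sum_(i <- r) c i *: cm f (F i).
Proof. by rewrite raddf_sum; apply: eq_bigr => i _ /=; rewrite cmZr. Qed.

Lemma cm_suml I (r : seq I) (F : I -> ncalg k) (c : I -> k) h :
  cm (\sum_(i <- r) c i *: F i) h = \sum_(i <- r) c i *: cm (F i) h.
Proof. by rewrite -cmN linear_sum -sumrN; apply: eq_bigr => i _; rewrite cmN cmZl. Qed.

Lemma cm_jacobi f g h : cm f (cm g h) = cm (cm f g) h + cm g (cm f h).
Proof.
rewrite /cm !mulrBl !mulrBr !mulrA !opprB [RHS]addrACA !subrKA.
by rewrite addrACA [RHS]addrACA (addrC (- _)).
Qed.

Lemma delta_cm b f h : delta b (cm f h) = cm (delta b f) h + cm f (delta b h).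
Proof.
by rewrite /cm raddfB /= !deltaM (addrC (delta b h * f)) opprD addrACA.
Qed.

(** On words in a single letter the two products are the same sum read in opposite orders.
    Commutators thus vanish once the other letter is set to 0, which supplies the initial conditions
    for [delta_inj]. *)
Lemma cm_nseq f h n b : cm f h (nseq n b) = 0.
Proof.
rewrite /cm nc_subE -!nc_mulE /nc_mul (reindex_inj rev_ord_inj) /= size_nseq.
rewrite -sumrB big1 // => i _; rewrite subSS.
have ni : (i <= n)%N by rewrite -ltnS.
rewrite mulrC !take_nseq ?leq_subr // !drop_nseq subKn //.
by rewrite subrr.
Qed.

Lemma delta_inj b f h : delta b f = delta b h -> agree_without b f h -> f = h.
Proof.
move=> df fh; apply/funext => w; have [bw|/fh//] := boolP (b \in w).
have cw : (count_mem b w)%:R != 0 :> k by rewrite natf_neq0_char0 // -has_count has_pred1.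
by apply: (mulfI cw); apply: (congr1 (fun f : ncalg k => f w) df).
Qed.

Fixpoint tbr (d : bool) t : ncalg k :=
  if t is Node a b then cm (tbr false a) (tbr true b) else xvar d.

(* K_T / (l_T! r_T!), see nlabelings_coef. *)
Fixpoint coef t : k :=
  if t is Node a b then
    (ndir false false a * ndir true true b)%:R
    / (ndir false true t * ndir true true t)%:R * (coef a * coef b)
  else 1.

Definition phi t : ncalg k :=
  if t is Leaf then xvar false + xvar true else coef t *: tbr true t.

Lemma delta_tbr c d t : delta c (tbr d t) = (ndir c d t)%:R *: tbr d t.
Proof.
elim: t d => [|a IHa b IHb] d /=.
  by rewrite delta_xvar /ndir /= eq_sym; case: eqP => _; rewrite ?scale1r ?scale0r.
by rewrite delta_cm IHa IHb cmZl cmZr ndir_node natrD scalerDl.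
Qed.

(** The convention that [Leaf] evaluates to X + Y makes the leaf fit the general formula: the
    derivation selects the letter of direction [c]. For a node the direction of the root edge is
    immaterial. *)
Lemma delta_phi c t : delta c (phi t) = ((ndir c c t)%:R * coef t) *: tbr c t.
Proof.
case: t => [|a b].
  rewrite linearD /= !delta_xvar /ndir /= eqxx mulr1 scale1r.
  by case: c; rewrite ?addr0 ?add0r.
by rewrite linearZ /= (delta_tbr c true (Node a b)) scalerA mulrC !ndir_node.
Qed.

(** The denominator of [coef] cancels the degrees of the whole bracket in X and Y, and its numerator
    supplies the X-degree of the left factor and the Y-degree of the right factor. *)
Lemma delta_phi_node a b :
  delta false (delta true (phi (Node a b))) = cm (delta false (phi a)) (delta true (phi b)).
Proof.
rewrite !delta_phi deltaZ delta_tbr cmZl cmZr !scalerA.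
congr (_ *: _); rewrite /coef -/coef [RHS]mulrACA -natrM mulrAC -natrM.
rewrite (mulnC (ndir true _ _)) mulrC [LHS]mulrAC divfK //.
by rewrite natf_neq0_char0 // muln_gt0 !ndir_node_gt0.
Qed.

Lemma phi_node_nseq a b n c : phi (Node a b) (nseq n c) = 0.
Proof. by rewrite /phi nc_scaleE /= cm_nseq mulr0. Qed.

(* phi (s |> t) for d = true; for d = false, its analogue for a left pointing
   root edge, which is needed in the induction on t. *)
Definition graft_sum d s t : ncalg k :=
  \sum_(e <- edges t) (if last d e then 1 else -1) *: phi (graft_rec d s e t).

Lemma graft_sum_nseq d s t n c : graft_sum d s t (nseq n c) = 0.
Proof.
rewrite /graft_sum nc_sumE big1_seq // => e _; rewrite nc_scaleE.
have -> : forall u, (1 < nleaves u)%N -> phi u (nseq n c) = 0.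
- by move=> [|a b] // _; exact: phi_node_nseq.
- by rewrite mulr0.
by rewrite nleaves_graft_rec -(addn1 1) leq_add ?nleaves_gt0.
Qed.

(** For a left pointing root edge the sign -1 undoes the exchange of the two children. *)
Lemma delta2_graft_root d s t :
  delta false (delta true ((if d then 1 else -1) *: phi (if d then Node s t else Node t s)))
  = cm (delta (~~ d) (phi s)) (delta d (phi t)).
Proof.
case: d => /=; rewrite ?scale1r ?scaleN1r; first exact: delta_phi_node.
by rewrite !raddfN /= delta_phi_node cmN.
Qed.

Lemma graft_sum_node d s a b : graft_sum d s (Node a b) =
  (if d then 1 else -1) *: phi (if d then Node s (Node a b) else Node (Node a b) s)
  + (\sum_(e <- edges a) (if last false e then 1 else -1) *: phi (Node (graft_rec false s e a) b)
  + \sum_(e <- edges b) (if last true e then 1 else -1) *: phi (Node a (graft_rec true s e b))).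
Proof. by rewrite /graft_sum /= big_cons big_cat !big_map; case: d. Qed.

(** The hypothesis is the claim differentiated once more, in the other letter, with its right-hand
    side expanded by Leibniz. That derivation is injective up to words in the letter [d] alone,
    where both sides vanish. *)
Lemma delta_graft_sum_suff d s t :
  delta false (delta true (graft_sum d s t))
    = cm (delta (~~ d) (phi s)) (delta d (phi t))
      + cm (phi s) (delta false (delta true (phi t))) ->
  delta d (graft_sum d s t) = cm (phi s) (delta d (phi t)).
Proof.
have comm f : delta (~~ d) (delta d f) = delta false (delta true f).
  by case: d => //; rewrite deltaC.
move=> E; apply: (@delta_inj (~~ d)); first by rewrite comm E delta_cm comm.
move=> w dw; have -> : w = nseq (size w) d.
  by apply/all_pred1P/allP => c cw; apply: contraR dw; case: c d cw {comm E} => [] [].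
by rewrite /delta graft_sum_nseq mulr0 cm_nseq.
Qed.

(** Grafting at the root edge yields the first Leibniz term. Grafting on the edges of [a] and of
    [b], covered by the induction hypotheses for a left and a right pointing root edge, yields the
    two terms of the Jacobi expansion. *)
Lemma delta_graft_sum d s t : delta d (graft_sum d s t) = cm (phi s) (delta d (phi t)).
Proof.
elim: t d => [|a IHa b IHb] d; apply: delta_graft_sum_suff.
  have -> : graft_sum d s Leaf = (if d then 1 else -1) *: phi (if d then Node s Leaf else Node Leaf s).
    by rewrite /graft_sum /= big_seq1; case: d.
  rewrite delta2_graft_root (_ : delta false (delta true (phi Leaf)) = 0) ?raddf0 ?addr0 //.
  by rewrite delta_phi deltaZ delta_xvar scaler0.
rewrite graft_sum_node !raddfD /= delta2_graft_root delta_phi_node cm_jacobi.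
congr (_ + (_ + _)).
  rewrite -IHa !delta_sum cm_suml.
  by apply: eq_bigr => e _; rewrite delta_phi_node.
rewrite -IHb !delta_sum cm_sumr.
by apply: eq_bigr => e _; rewrite delta_phi_node.
Qed.

End TreeEvaluation.

(** * Evaluation of tree series, and the equation for the Eulerian coefficients *)

Section SeriesEvaluation.
Variable k : fieldType.
Hypothesis char0 : [pchar k] =i pred0.
Implicit Types (f g h y z : ncalg k) (w : seq bool) (s t u : pbtree).
Implicit Types (A B : tree_series k) (F H : pbtree -> ncalg k).

Definition graded F := forall t w, size w != nleaves t -> F t w = 0.

(** For [graded] [F], trees whose number of leaves is not the length of the word contribute nothing,
    so the value of an infinite tree series is a finite sum in each coefficient. *)
Definition tsum F A : ncalg k := fun w => \sum_(t <- trees (size w)) A t * F t w.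

Lemma tsumM F H A B w : graded F -> graded H ->
  (tsum F A * tsum H B) w = \sum_(1 <= i < size w) \sum_(s <- trees i)
    \sum_(t <- trees (size w - i)) A s * B t * (F s * H t) w.
Proof.
move=> gF gH; rewrite -nc_mulE /nc_mul.
rewrite -(big_mkord xpredT (fun i => tsum F A (take i w) * tsum H B (drop i w))).
have T0 F' A' : tsum F' A' [::] = 0 by rewrite /tsum big_nil.
case: w => [|b w]; first by rewrite big_nat1 T0 mul0r big_geq.
set v := b :: w; rewrite big_ltn // big_nat_recr //= ?take0 T0 mul0r add0r.
rewrite drop_oversize // T0 mulr0 addr0; apply: eq_big_nat => i /andP[i0 iv].
rewrite /tsum size_takel ?size_drop ?(ltnW iv) // big_distrlr /=.
apply: eq_big_seq => s; rewrite mem_trees => /eqP si.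
apply: eq_big_seq => t; rewrite mem_trees => /eqP ti.
rewrite mulrACA; congr (_ * _); rewrite -nc_mulE /nc_mul.
have iv' : (i < (size v).+1)%N by rewrite ltnS ltnW.
rewrite (bigD1 (Ordinal iv')) //= [X in _ = _ + X]big1 ?addr0 // => j ji.
rewrite gF ?mul0r // si size_takel //; last by rewrite -ltnS; apply: (ltn_ord j).
Qed.

(** Indexing by the same pairs (s, t) as in [tsumM] lets a commutator of evaluated series be
    computed term by term. *)
Lemma tsumM_rev F H A B w : graded F -> graded H ->
  (tsum H B * tsum F A) w = \sum_(1 <= i < size w) \sum_(s <- trees i)
    \sum_(t <- trees (size w - i)) A s * B t * (H t * F s) w.
Proof.
move=> gF gH; rewrite tsumM // big_nat_rev; apply: eq_big_nat => i /andP[i0 iw].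
rewrite exchange_big /= add1n subSS subKn ?(ltnW iw) //; apply: eq_bigr => s _.
by apply: eq_bigr => t _; rewrite (mulrC (B t)).
Qed.

Lemma tsum_delta b F A : delta b (tsum F A) = tsum (fun t => delta b (F t)) A.
Proof.
apply/funext => w; rewrite /delta /tsum mulr_sumr.
by apply: eq_bigr => t _; rewrite mulrCA.
Qed.

Lemma graded_delta b F : graded F -> graded (fun t => delta b (F t)).
Proof. by move=> gF t w wt; rewrite /delta gF ?mulr0. Qed.

Lemma graded_mul m n f h : (forall w, size w != m -> f w = 0) ->
  (forall w, size w != n -> h w = 0) ->
  forall w, size w != (m + n)%N -> (f * h) w = 0.
Proof.
move=> fm hn w wmn; rewrite -nc_mulE /nc_mul big1 // => i _.
have iw : (i <= size w)%N by rewrite -ltnS.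
have [im|/fm->] := eqVneq (size (take i w)) m; last by rewrite mul0r.
rewrite hn ?mulr0 //; apply: contraNneq wmn => <-.
by rewrite -im -size_cat cat_take_drop.
Qed.

Lemma graded_tbr d : graded (tbr k d).
Proof.
move=> t; elim: t d => [|a IHa b IHb] d w wt /=.
  by rewrite /xvar /nc_var; case: eqP => // wd; rewrite wd in wt.
rewrite /cm nc_subE (graded_mul (IHa _) (IHb _)) // (graded_mul (IHb _) (IHa _)) ?subr0 //.
by rewrite addnC.
Qed.

Lemma graded_phi : graded (@phi k).
Proof.
move=> [|a b] w wt; last by rewrite /phi nc_scaleE graded_tbr ?mulr0.
by rewrite /phi nc_addE !(@graded_tbr _ Leaf w wt : xvar k _ w = 0) addr0.
Qed.

Definition psum := tsum (@phi k).

Lemma sum_prelie_tree s t w : size w = (nleaves s + nleaves t)%N ->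
  \sum_(u <- trees (size w)) prelie_tree k s t u * phi k u w = graft_sum k true s t w.
Proof.
move=> wst; rewrite /graft_sum nc_sumE; under eq_bigr do rewrite /prelie_tree mulr_suml.
rewrite exchange_big /=; apply: eq_bigr => e _; rewrite nc_scaleE /right_pointing.
rewrite (bigD1_seq (graft s e t)) ?trees_uniq //=; last first.
  by rewrite mem_trees wst nleaves_graft_rec.
rewrite eqxx mulr1 big1 ?addr0 // => u /negPf ug.
by rewrite eq_sym ug mulr0 mul0r.
Qed.

(** Bilinear extension of [delta_graft_sum]. After [delta true], left pre-Lie multiplication by [A]
    becomes the adjoint action of its value, so pre-Lie powers become powers of ad. *)
Lemma delta_psum_prelie A B :
  delta true (psum (prelie A B)) = cm (psum A) (delta true (psum B)).
Proof.
apply/funext => w; set n := size w.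
transitivity (\sum_(1 <= i < n) \sum_(s <- trees i) \sum_(t <- trees (n - i))
    A s * B t * delta true (graft_sum k true s t) w).
  rewrite /psum /tsum -/n /delta -/n.
  transitivity ((count_mem true w)%:R * \sum_(u <- trees n) \sum_(1 <= i < n)
     \sum_(s <- trees i) \sum_(t <- trees (n - i)) A s * B t * prelie_tree k s t u * phi k u w).
    congr (_ * _); apply: eq_big_seq => u; rewrite mem_trees => /eqP un.
    rewrite /prelie un !mulr_suml; apply: eq_bigr => i _; rewrite !mulr_suml.
    by apply: eq_bigr => s _; rewrite !mulr_suml.
  rewrite exchange_big mulr_sumr; apply: eq_big_nat => i /andP[i0 iw].
  rewrite exchange_big mulr_sumr; apply: eq_big_seq => s; rewrite mem_trees => /eqP si.
  rewrite exchange_big mulr_sumr; apply: eq_big_seq => t; rewrite mem_trees => /eqP ti.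
  rewrite [RHS]mulrCA; congr (_ * _); rewrite -sum_prelie_tree; last first.
    by rewrite si ti subnKC // ltnW.
  by rewrite mulr_sumr; apply: eq_bigr => u _; rewrite mulrA.
rewrite /cm nc_subE {2}/psum {2}/psum tsum_delta.
have gp := graded_phi; have gd := graded_delta true gp.
rewrite (tsumM _ _ _ gp gd) (tsumM_rev _ _ _ gp gd) -sumrB; apply: eq_bigr => i _.
rewrite -sumrB; apply: eq_bigr => s _; rewrite -sumrB; apply: eq_bigr => t _.
by rewrite delta_graft_sum // -mulrBr.
Qed.

Lemma delta_psum_prelie_pow A m :
  delta true (psum (prelie_pow A m)) = adn (psum A) m (delta true (psum A)).
Proof. by elim: m => [//|m IH]; rewrite delta_psum_prelie IH. Qed.

Local Notation E := (eulerian k).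

Lemma eulerian_leaf : E Leaf = 1.
Proof.
have := eulerianP k Leaf; rewrite big_nat1 expr2 mulrNN mulr1 divr1 mul1r.
by rewrite /prelie_pow /= => ->.
Qed.

Lemma psum_unit : psum (tree_unit k) = xvar k false + xvar k true.
Proof.
apply/funext => w; rewrite /psum /tsum.
have [w1|w1] := eqVneq (size w) 1%N; last first.
  rewrite big1_seq => [|t /=]; last first.
    rewrite mem_trees /tree_unit; have [->|] := eqVneq t Leaf; rewrite ?mul0r //.
    by rewrite eq_sym (negPf w1).
  by rewrite -[RHS]/(phi k Leaf w) graded_phi.
by rewrite w1 big_seq1 mul1r.
Qed.

Lemma nc_bch_psum : nc_bch k = psum E.
Proof.
apply: nc_bch_unique => //.
- by case=> // _; rewrite /psum /tsum big_nil.
(* With Y set to 0 all nodes vanish, being commutators in one letter, and the leaf, with coefficient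
   1, leaves X. *)
- move=> w tw; have -> : w = nseq (size w) false.
    by apply/all_pred1P/allP => -[] cw //; rewrite cw in tw.
  set n := size w; rewrite /psum /tsum size_nseq.
  transitivity (\sum_(t <- trees n) tree_unit k t * phi k t (nseq n false)).
    apply: eq_bigr => -[|a b] _; first by rewrite eulerian_leaf.
    by rewrite phi_node_nseq !mulr0.
  have := congr1 (fun f : ncalg k => f (nseq n false)) psum_unit.
  rewrite /psum /tsum size_nseq => ->.
  by rewrite nc_addE {2}/xvar /nc_var; case: (n) => [|[|m]] /=; rewrite addr0.
move=> w; set n := size w.
(* Y is the image of X + Y under [delta true], and X + Y is the value of [tree_unit], which the
   Eulerian equation expands into pre-Lie powers. *)
have := congr1 (fun f : ncalg k => delta true f w) psum_unit.
rewrite raddfD /= nc_addE !delta_xvar /= add0r => <-.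
transitivity (\sum_(0 <= m < n) (-1) ^+ m / m.+1`!%:R *
   delta true (psum (prelie_pow E m)) w).
  by rewrite big_mkord; apply: eq_bigr => i _; rewrite delta_psum_prelie_pow.
rewrite /delta /psum /tsum -/n.
transitivity ((count_mem true w)%:R *  \sum_(0 <= m < n) \sum_(t <- trees n) 
   (-1) ^+ m / m.+1`!%:R * prelie_pow E m t * phi k t w).
  rewrite mulr_sumr; apply: eq_bigr => m _; rewrite mulrCA; congr (_ * _); rewrite mulr_sumr.
  by apply: eq_bigr => t _; rewrite mulrA.
congr (_ * _); rewrite exchange_big; apply: eq_big_seq => t.
rewrite mem_trees -mulr_suml => /eqP tn; congr (_ * _).
rewrite -eulerianP tn [RHS]big_add1; apply: eq_bigr => m _.
by rewrite !exprS !mulN1r opprK.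
Qed.

End SeriesEvaluation.

(** * Counting labelings *)

Fixpoint bmasks (n j : nat) : seq bitseq :=
  match n, j with
  | 0, 0 => [:: [::]]
  | 0, _.+1 => [::]
  | n'.+1, 0 => map (cons false) (bmasks n' 0)
  | n'.+1, j'.+1 => map (cons true) (bmasks n' j') ++ map (cons false) (bmasks n' j)
  end.

Lemma size_bmasks n j : size (bmasks n j) = 'C(n, j).
Proof.
elim: n j => [|n IH] [|j] //=; first by rewrite size_map IH !bin0.
by rewrite size_cat !size_map !IH binS addnC.
Qed.

Lemma mem_map_cons (T : eqType) (x y : T) (l : seq T) (s : seq (seq T)) :
  (y :: l \in map (cons x) s) = (y == x) && (l \in s).
Proof.
apply/mapP/andP => [[l' ls [-> ->]]|[/eqP-> ls]]; first by rewrite eqxx.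
by exists l.
Qed.

Lemma nil_map_cons (T : eqType) (x : T) (s : seq (seq T)) : ([::] \in map (cons x) s) = false.
Proof. by apply/mapP => -[]. Qed.

Lemma mem_bmasks n j m : (m \in bmasks n j) = (size m == n) && (count id m == j).
Proof.
elim: n j m => [|n IH] [|j] [|b m] //=; rewrite ?mem_cat ?nil_map_cons //.
  by rewrite !mem_map_cons IH eqSS; case: b; rewrite //= andbF.
by rewrite !mem_map_cons !IH !eqSS; case: b; rewrite //= ?orbF.
Qed.

Lemma bmasks_uniq n j : uniq (bmasks n j).
Proof.
have inj b : injective (cons b : bitseq -> bitseq) by move=> ? ? [].
elim: n j => [|n IH] [|j] //=; first by rewrite map_inj_uniq.
rewrite cat_uniq !map_inj_uniq // !IH andbT /=; apply/hasPn => -[|b m].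
  by rewrite nil_map_cons.
by rewrite !mem_map_cons => /andP[/eqP-> _]; rewrite negb_and.
Qed.

Lemma size_fibers (S T : eqType) (f : S -> T) (s : seq S) (r : seq T) :
  uniq r -> {in s, forall x, f x \in r} ->
  size s = \sum_(y <- r) count (fun x => f x == y) s.
Proof.
move=> ur; elim: s => [|x s IH] fr; first by rewrite big1.
rewrite /= big_split /= -IH => [|z zs]; last by rewrite fr // inE zs orbT.
rewrite (bigD1_seq (f x)) ?fr ?inE ?eqxx //= big1 // => y /negPf.
by rewrite eq_sym => ->.
Qed.

Lemma perm_mask_cat (T : eqType) (m : bitseq) (s : seq T) : size m = size s ->
  perm_eq (mask m s ++ mask (map negb m) s) s.
Proof.
elim: s m => [|x s IH] [|[] m] //= [/IH]; first by rewrite perm_cons.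
by move=> IHm; rewrite -(cat1s x (mask _ _)) perm_catCA perm_cons.
Qed.

Lemma map_mem_mask (T : eqType) (m : bitseq) (s : seq T) : uniq s -> size m = size s ->
  map (mem (mask m s)) s = m.
Proof.
elim: s m => [|x s IH] [|b m] //= /andP[xs us] [ms].
have xm : x \in mask m s = false by apply: contraNF xs => /mem_mask.
congr (_ :: _); first by case: b; rewrite ?inE ?eqxx.
rewrite -[RHS](IH m us ms); apply/eq_in_map => y ys /=.
by case: b => //=; rewrite !inE; case: eqP => // yx; rewrite -yx ys in xs.
Qed.

Lemma size_leaf_dirs d t : size (leaf_dirs d t) = nleaves t.
Proof. by elim: t d => //= a IHa b IHb d; rewrite size_cat IHa IHb. Qed.

Lemma map_last_leaves d t : map (last d) (leaves t) = leaf_dirs d t.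
Proof.
elim: t d => //= a IHa b IHb d; rewrite map_cat -!map_comp.
by congr (_ ++ _); [rewrite -IHa|rewrite -IHb]; apply: eq_map.
Qed.

Lemma size_leaves t : size (leaves t) = nleaves t.
Proof. by rewrite -(size_leaf_dirs true) -map_last_leaves size_map. Qed.

Lemma ndirD d t : (ndir false d t + ndir true d t)%N = nleaves t.
Proof.
rewrite -(size_leaf_dirs d) /ndir -[RHS](count_predC (pred1 false)); congr (_ + _)%N.
by apply: eq_count => -[].
Qed.

Lemma count_negb_dirs d t : count id (map negb (leaf_dirs d t)) = ndir false d t.
Proof. by rewrite count_map; apply: eq_count => -[]. Qed.

Lemma count_id_dirs d t : count id (leaf_dirs d t) = ndir true d t.
Proof. by apply: eq_count => -[]. Qed.

Lemma admissible_bounds t w c : size w = nleaves t -> admissible t w -> c \in w ->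
  (head 0 w <= c <= last 0 w)%N.
Proof.
case: t => [|a b] /=; last by move=> _ /and3P[/allP H _ _]; apply: H.
by case: w => [|x []] // _ _; rewrite inE => /eqP->; rewrite leqnn.
Qed.

Definition lefts d t (w : seq nat) := mask (map negb (leaf_dirs d t)) w.
Definition rights d t (w : seq nat) := mask (leaf_dirs d t) w.

(** A subtree receives an arbitrary part of the labels, so for the induction the labels [L] of the
    left pointing leaves and [R] of the right pointing ones are prescribed. That left labels lie
    below right labels is later expressed by [L ++ R] being increasing. *)
Definition labelings d t (L R : seq nat) :=
  [seq w <- permutations (L ++ R) | admissible t w && perm_eq (lefts d t w) L].

Lemma mem_labelings d t L R w : (w \in labelings d t L R) =
  [&& perm_eq w (L ++ R), admissible t w & perm_eq (lefts d t w) L].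
Proof. by rewrite mem_filter mem_permutations andbC. Qed.

Lemma lefts_node d a b wa wb : size wa = nleaves a ->
  lefts d (Node a b) (wa ++ wb) = lefts false a wa ++ lefts true b wb.
Proof. by move=> sa; rewrite /lefts map_cat mask_cat // size_map size_leaf_dirs. Qed.

Lemma size_lefts d t w : size w = nleaves t -> size (lefts d t w) = ndir false d t.
Proof. by move=> sw; rewrite size_mask ?count_negb_dirs // size_map size_leaf_dirs. Qed.

Lemma perm_lefts_rights d t w : size w = nleaves t ->
  perm_eq (lefts d t w ++ rights d t w) w.
Proof.
move=> sw; rewrite perm_catC /lefts; apply: perm_mask_cat.
by rewrite size_leaf_dirs.
Qed.

(** The smallest left label must go to the left subtree and the largest right label to the right
    one; the binomials count the distributions of the remaining labels, by the number received by
    [a]. *)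
Fixpoint nlab (t : pbtree) : nat :=
  if t is Node a b then
    ('C((ndir false true t).-1, (ndir false false a).-1) *
     'C((ndir true true t).-1, ndir true false a) * (nlab a * nlab b))%N
  else 1%N.

(* The left labels, followed by the right labels, both in increasing order, are
   distributed between the subtrees of the root, true meaning the left one: the
   left subtree gets the smallest label and the right subtree the largest one. *)
Definition splittings l r la ra :=
  [seq m1 ++ m2 | m1 <- map (cons true) (bmasks l.-1 la.-1),
                  m2 <- map (rcons^~ false) (bmasks r.-1 ra)].

Lemma size_splittings l r la ra :
  size (splittings l r la ra) = ('C(l.-1, la.-1) * 'C(r.-1, ra))%N.
Proof. by rewrite size_allpairs !size_map !size_bmasks. Qed.

Lemma splittingsP l r la ra m : (0 < l)%N -> (0 < r)%N -> (0 < la)%N ->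
  reflect (exists m1 m2, [/\ m = m1 ++ m2, size m1 = l /\ size m2 = r,
             head false m1 /\ ~~ last true m2, count id m1 = la & count id m2 = ra])
          (m \in splittings l r la ra).
Proof.
case: l r la => [|l] [|r] [|la] // _ _ _; apply: (iffP allpairsP) => /=.
  move=> -[[_ _]] /= [/mapP[m1 + ->] /mapP[m2 + ->] ->].
  rewrite !mem_bmasks => /andP[/eqP s1 /eqP c1] /andP[/eqP s2 /eqP c2].
  exists (true :: m1), (rcons m2 false).
  by rewrite /= size_rcons s1 s2 last_rcons -cats1 count_cat /= c1 c2 !addn0.
move=> [[|[] m1] [m2 [-> [s1 s2] [h1 h2] c1 c2]]] //.
case/lastP: m2 s2 h2 c2 => [|m2 [] ] //; rewrite ?last_rcons // size_rcons.
rewrite -cats1 count_cat addn0 cats1 => -[s2] _ c2.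
exists (true :: m1, rcons m2 false); split=> //=; apply: map_f; rewrite mem_bmasks ?s2 ?c2 ?eqxx //.
by move: s1 c1 => /= [->] /eqP; rewrite add1n eqSS => /eqP->; rewrite !eqxx.
Qed.

Lemma splittings_uniq l r la ra : uniq (splittings l r la ra).
Proof.
apply: allpairs_uniq; rewrite ?map_inj_uniq ?bmasks_uniq //.
- by move=> ? ? [].
- exact: rcons_injl.
move=> [m1 m2] [n1 n2] /allpairsP[[p1 p2] /= [/mapP[p P ->] _ [-> ->]]].
move=> /allpairsP[[q1 q2] /= [/mapP[q Q ->] _ [-> ->]]] /eqP.
move: P Q; rewrite !mem_bmasks => /andP[/eqP sp _] /andP[/eqP sq _].
by rewrite /= -!cat_cons eqseq_cat /= ?sp ?sq // => /andP[/eqP[->] /eqP->].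
Qed.

Lemma labelings_leaf d L R : size L = ndir false d Leaf -> size R = ndir true d Leaf ->
  size (labelings d Leaf L R) = 1%N.
Proof.
move=> sL sR; have [x [s1 L1]] : exists x, L ++ R = [:: x] /\ L = if d then [::] else [:: x].
  case: d sL sR => /=; case: L => [|x [|? ?]] //; case: R => [|y [|? ?]] //; first by exists y.
  by exists x.
rewrite /labelings (all_filterP _) s1 ?size_permutations //.
apply/allP => w; rewrite mem_permutations => /perm_small_eq -> //.
by rewrite L1 /lefts /=; case: (d); apply: perm_refl.
Qed.

Lemma filter_mem_cat (T : eqType) (s1 s2 t1 t2 : seq T) : uniq (s1 ++ s2) ->
  {subset t1 <= s1} -> {subset t2 <= s2} ->
  filter (mem s1) (t1 ++ t2) = t1 /\ filter (predC (mem s1)) (t1 ++ t2) = t2.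
Proof.
rewrite cat_uniq => /and3P[_ /hasPn s12 _] sub1 sub2; rewrite !filter_cat.
have n2 x : x \in t2 -> (x \in s1) = false by move=> /sub2/s12/negPf.
split.
  rewrite (all_filterP _); last by apply/allP => x /sub1.
  by rewrite (eq_in_filter (a2 := pred0)) ?filter_pred0 ?cats0.
rewrite (eq_in_filter (a2 := pred0)) ?filter_pred0 => [|x /sub1 /= ->] //.
by apply/all_filterP/allP => x /n2 /= ->.
Qed.

Lemma rights_node d a b wa wb : size wa = nleaves a ->
  rights d (Node a b) (wa ++ wb) = rights false a wa ++ rights true b wb.
Proof. by move=> sa; rewrite /rights mask_cat ?size_leaf_dirs. Qed.

Lemma perm_of_lefts_rights d t w L R : size w = nleaves t ->
  perm_eq (lefts d t w) L -> perm_eq (rights d t w) R -> perm_eq w (L ++ R).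
Proof. by move=> sw wL wR; rewrite -(permPl (perm_lefts_rights d sw)) perm_cat. Qed.

(** * Labelings of a tree through labelings of its two subtrees *)

Section SizeLabelingsNode.
Variables (d : bool) (a b : pbtree) (L R : seq nat).
Local Notation la := (ndir false false a).
Local Notation ra := (ndir true false a).
Local Notation lb := (ndir false true b).
Local Notation rb := (ndir true true b).
Local Notation s := (L ++ R).
Hypotheses (sorted_s : sorted ltn s) (size_L : size L = (la + lb)%N)
  (size_R : size R = (ra + rb)%N).

Let uniq_s : uniq s. Proof. exact: (sorted_uniq ltn_trans ltnn). Qed.

Let splitting (w : seq nat) : bitseq := map (mem (take (nleaves a) w)) s.

Let head_s : head 0 s \in L.
Proof.
by case: L size_L (ndir_gt0 false a) => [|x l] /=; [case: la|rewrite inE eqxx].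
Qed.

Let last_s : last 0 s \in R.
Proof.
have R0 : R != [::] by case: R size_R (ndir_gt0 true b) => [|? ?] //=; rewrite addnC; case: rb.
by rewrite last_cat; case: R R0 => [|y l] // _; exact: mem_last.
Qed.

Let bounds_s c : c \in s -> (head 0 s <= c <= last 0 s)%N.
Proof.
have : pairwise leq s by rewrite -(sorted_pairwise leq_trans); apply: sub_sorted sorted_s => x y /ltnW.
move=> ps cs; apply/andP; split.
  case: s ps cs => //= x l /andP[/allP xl _]; rewrite inE => /predU1P[->|/xl] //.
case/lastP: s ps cs => // l y; rewrite pairwise_rcons last_rcons => /andP[/allP ly _].
by rewrite mem_rcons inE => /predU1P[->|/ly].
Qed.

Let sub_lefts c t w : {subset lefts c t w <= w}. Proof. by move=> x /mem_mask. Qed.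
Let sub_rights c t w : {subset rights c t w <= w}. Proof. by move=> x /mem_mask. Qed.

Let labelings_split (w : seq nat) (wa := take (nleaves a) w) (wb := drop (nleaves a) w) :
  w \in labelings d (Node a b) L R ->
  [/\ w = wa ++ wb, perm_eq w s, size wa = nleaves a, size wb = nleaves b &
    [/\ perm_eq (lefts false a wa) (filter (mem wa) L),
       perm_eq (rights false a wa) (filter (mem wa) R),
       perm_eq (lefts true b wb) (filter (predC (mem wa)) L) &
       perm_eq (rights true b wb) (filter (predC (mem wa)) R)]].
Proof.
rewrite mem_labelings => /and3P[ws _ wL].
have Ew : w = wa ++ wb by rewrite cat_take_drop.
have sw : size w = (nleaves a + nleaves b)%N.
  by rewrite (perm_size ws) size_cat size_L size_R addnACA !ndirD.
have sa : size wa = nleaves a by rewrite size_takel // sw leq_addr.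
have sb : size wb = nleaves b by rewrite size_drop sw addKn.
have wR : perm_eq (rights d (Node a b) w) R.
  rewrite -(perm_cat2l L) -(permPr ws) -(permPr (perm_lefts_rights (t := Node a b) d sw)) perm_cat2r.
  by rewrite perm_sym.
have uw : uniq (wa ++ wb) by rewrite -Ew (perm_uniq ws).
rewrite Ew lefts_node // in wL; rewrite Ew rights_node // in wR.
have [la1 lb1] := filter_mem_cat uw (@sub_lefts false a wa) (@sub_lefts true b wb).
have [ra1 rb1] := filter_mem_cat uw (@sub_rights false a wa) (@sub_rights true b wb).
split=> //; split.
- by rewrite -[X in perm_eq X]la1 perm_filter.
- by rewrite -[X in perm_eq X]ra1 perm_filter.
- by rewrite -[X in perm_eq X]lb1 perm_filter.
- by rewrite -[X in perm_eq X]rb1 perm_filter.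
Qed.

Let ends w : w \in labelings d (Node a b) L R -> head 0 w = head 0 s /\ last 0 w = last 0 s.
Proof.
move=> wl; have [_ ws _ _ _] := labelings_split wl.
move: wl; rewrite mem_labelings => /and3P[_ /= /and3P[/allP bw _ _] _].
have hs : head 0 s \in w by rewrite (perm_mem ws) mem_cat head_s.
have ls : last 0 s \in w by rewrite (perm_mem ws) mem_cat last_s orbT.
have [hw lw] : head 0 w \in w /\ last 0 w \in w.
  by case: (w) hs => // x l _; rewrite /= mem_head mem_last.
have /andP[h1 _] := bw _ hs; have /andP[_ l1] := bw _ ls.
rewrite (perm_mem ws) in hw; rewrite (perm_mem ws) in lw.
have /andP[h2 _] := bounds_s hw; have /andP[_ l2] := bounds_s lw.
by split; apply/eqP; rewrite eqn_leq ?h1 ?h2 ?l1 ?l2.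
Qed.

(** The minimum sits on the first leaf, which belongs to [a], and the maximum on the last leaf,
    which belongs to [b]; hence the two forced marks. *)
Let splitting_in w : w \in labelings d (Node a b) L R ->
  splitting w \in splittings (la + lb) (ra + rb) la ra.
Proof.
move=> wl; have [Ew ws sa sb [pla pra _ _]] := labelings_split wl.
have [hw lw] := ends wl; set wa := take _ w in Ew sa sb pla pra; set wb := drop _ w in Ew sb.
have uw : uniq w by rewrite (perm_uniq ws).
apply/splittingsP; rewrite ?addn_gt0 ?ndir_gt0 ?orbT //.
exists (map (mem wa) L), (map (mem wa) R); split.
- exact: map_cat.
- by rewrite !size_map.
- split.
    have [x [l wal]] : exists x l, wa = x :: l.
      by case: (wa) sa (nleaves_gt0 a) => [<-|x l] // _ _; exists x, l.
    have : head 0 L \in wa.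
      suff -> : head 0 L = x by rewrite wal mem_head.
      by move: hw; rewrite Ew wal /= => ->; case: L head_s.
    by case: L head_s => //= y l' _ ->.
  have : last 0 s \notin wa.
    rewrite -lw Ew; move: uw; rewrite Ew cat_uniq => /and3P[_ /hasPn uw _].
    apply: uw; rewrite last_cat; case: (wb) sb => [|x l] /=; last by rewrite mem_last.
    by case: (nleaves b) (nleaves_gt0 b).
  suff -> : last true (map (mem wa) R) = mem wa (last 0 s) by [].
  by rewrite last_cat; case: R last_s => // y l _; apply: (last_map (mem wa)).
- by rewrite count_map -size_filter -(perm_size pla) size_lefts.
- rewrite count_map -size_filter -(perm_size pra) size_mask ?count_id_dirs //.
  by rewrite size_leaf_dirs.
Qed.

Let fiber m1 m2 :
  size m1 = size L -> size m2 = size R -> head false m1 -> ~~ last true m2 ->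
  count id m1 = la -> count id m2 = ra ->
  perm_eq [seq w <- labelings d (Node a b) L R | splitting w == m1 ++ m2]
    [seq wa ++ wb | wa <- labelings false a (mask m1 L) (mask m2 R),
       wb <- labelings true b (mask (map negb m1) L) (mask (map negb m2) R)].
Proof.
move=> s1 s2 h1 l2 c1 c2; set La := mask m1 L; set Ra := mask m2 R.
set Lb := mask (map negb m1) L; set Rb := mask (map negb m2) R.
have s12 : size (m1 ++ m2) = size s by rewrite !size_cat s1 s2.
have Ea : La ++ Ra = mask (m1 ++ m2) s by rewrite mask_cat.
have Eb : Lb ++ Rb = mask (map negb (m1 ++ m2)) s by rewrite map_cat mask_cat ?size_map.
have pab : perm_eq ((La ++ Ra) ++ (Lb ++ Rb)) s by rewrite Ea Eb perm_mask_cat.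
have pL : perm_eq (La ++ Lb) L by apply: perm_mask_cat.
have sz wa : wa \in labelings false a La Ra -> size wa = nleaves a.
  by rewrite mem_labelings => /andP[/perm_size-> _]; rewrite size_cat !size_mask // c1 c2 ndirD.
have szb wb : wb \in labelings true b Lb Rb -> size wb = nleaves b.
  rewrite mem_labelings => /andP[/perm_size-> _]; apply/eqP.
  rewrite -(eqn_add2l (size (La ++ Ra))) -size_cat (perm_size pab) !size_cat size_L size_R.
  by rewrite !size_mask // c1 c2 addnACA !ndirD.
apply: uniq_perm.
- by rewrite !filter_uniq // permutations_uniq.
- apply: allpairs_uniq; rewrite ?filter_uniq ?permutations_uniq //.
  move=> [w1 w2] [v1 v2] /allpairsP[[? ?] /= [P1 P2 [-> ->]]].
  move=> /allpairsP[[? ?] /= [Q1 Q2 [-> ->]]] /eqP.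
  by rewrite eqseq_cat ?(sz _ P1) ?(sz _ Q1) // => /andP[/eqP-> /eqP->].
move=> w; rewrite mem_filter; apply/andP/allpairsP => [[/eqP sw wl]|].
  have [Ew ws sa sb [pla pra plb prb]] := labelings_split wl.
  move: sw; rewrite /splitting map_cat => /eqP; rewrite eqseq_cat ?size_map //.
  move=> /andP[/eqP Em1 /eqP Em2].
  move: wl; rewrite mem_labelings => /and3P[_ /= /and3P[_ adma admb] _].
  have negE (T : seq nat) (p : pred nat) : map (predC p) T = map negb (map p T) by rewrite -map_comp.
  rewrite filter_mask negE Em1 in plb; rewrite filter_mask negE Em2 in prb.
  rewrite filter_mask Em1 in pla; rewrite filter_mask Em2 in pra.
  exists (take (nleaves a) w, drop (nleaves a) w); split=> //=.
    by rewrite mem_labelings adma pla andbT (perm_of_lefts_rights _ pla pra).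
  by rewrite mem_labelings admb plb andbT (perm_of_lefts_rights _ plb prb).
move=> [[wa wb] /= [wla wlb ->]]; have [sa sb] := (sz _ wla, szb _ wlb).
move: wla wlb; rewrite !mem_labelings => /and3P[pa adma la_a] /and3P[pb admb lb_b].
have pw : perm_eq (wa ++ wb) s by rewrite -(permPr pab) perm_cat.
split.
  apply/eqP; rewrite /splitting take_size_cat // -[RHS](map_mem_mask uniq_s s12) -Ea.
  by apply: eq_map => x; apply: (perm_mem pa).
have sub_wa x : x \in wa -> x \in s by move=> xa; rewrite -(perm_mem pw) mem_cat xa.
have sub_wb x : x \in wb -> x \in s by move=> xb; rewrite -(perm_mem pw) mem_cat xb orbT.
(* Admissibility of the concatenation at the root: the minimum of [s] goes to [a] because [m1]
   starts with true, and admissibility of [wa] puts it on the first leaf. The maximum is treated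
   symmetrically with [wb]. *)
have hd : head 0 (wa ++ wb) = head 0 s.
  have hs : head 0 s \in wa.
    rewrite (perm_mem pa) mem_cat /La; apply/orP; left.
    by case: (L) head_s s1 h1 => // x l _; case: (m1) => // -[] m _ // _; rewrite /= mem_head.
  have /andP[h _] := admissible_bounds sa adma hs.
  have -> : head 0 (wa ++ wb) = head 0 wa by case: (wa) hs.
  apply/eqP; rewrite eqn_leq h; have /andP[-> //] : (head 0 s <= head 0 wa <= last 0 s)%N.
  by apply/bounds_s/sub_wa; case: (wa) hs => // x l _; rewrite mem_head.
have lst : last 0 (wa ++ wb) = last 0 s.
  have ls : last 0 s \in wb.
    rewrite (perm_mem pb) mem_cat /Rb last_cat; apply/orP; right.
    case/lastP: (R) last_s s2 => // l y _; rewrite last_rcons size_rcons.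
    case/lastP: (m2) l2 => // m c; rewrite last_rcons size_rcons => /negPf-> [sm].
    by rewrite map_rcons mask_rcons ?size_map // mem_cat mem_seq1 eqxx orbT.
  have /andP[_ l] := admissible_bounds sb admb ls.
  have [-> lw] : last 0 (wa ++ wb) = last 0 wb /\ last 0 wb \in wb.
    by rewrite last_cat; case: (wb) ls => // x v _; rewrite /= mem_last.
  apply/eqP; rewrite eqn_leq l andbT.
  by have /andP[] := bounds_s (sub_wb _ lw).
rewrite pw lefts_node //= hd lst take_size_cat // drop_size_cat // adma admb.
rewrite -(permPr pL) (perm_cat la_a lb_b) !andbT.
by apply/allP => c; rewrite (perm_mem pw); apply: bounds_s.
Qed.

Lemma size_labelings_node :
  (forall L' R', sorted ltn (L' ++ R') -> size L' = la -> size R' = ra ->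
     size (labelings false a L' R') = nlab a) ->
  (forall L' R', sorted ltn (L' ++ R') -> size L' = lb -> size R' = rb ->
     size (labelings true b L' R') = nlab b) ->
  size (labelings d (Node a b) L R) = nlab (Node a b).
Proof.
move=> IHa IHb.
have [la0 rb0] := (ndir_gt0 false a, ndir_gt0 true b).
rewrite (size_fibers (f := splitting) (splittings_uniq (la + lb) (ra + rb) la ra)) //.
rewrite (eq_big_seq (fun=> (nlab a * nlab b)%N)); last first.
  move=> m /splittingsP[]; rewrite ?addn_gt0 ?la0 ?rb0 ?orbT // => m1 [m2 [-> [s1 s2] [h1 l2] c1 c2]].
  rewrite -size_L in s1; rewrite -size_R in s2.
  have n1 : count id (map negb m1) = lb.
    apply/eqP; rewrite -(eqn_add2l la) -{1}c1 -size_L -s1 count_map.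
    by apply/eqP; exact: count_predC.
  have n2 : count id (map negb m2) = rb.
    apply/eqP; rewrite -(eqn_add2l ra) -{1}c2 -size_R -s2 count_map.
    by apply/eqP; exact: count_predC.
  rewrite -size_filter (perm_size (fiber s1 s2 h1 l2 c1 c2)) size_allpairs IHa ?IHb //.
  - by rewrite -mask_cat ?size_map // sorted_mask //; apply: ltn_trans.
  - by rewrite size_mask ?size_map.
  - by rewrite size_mask ?size_map.
  - by rewrite -mask_cat // sorted_mask //; apply: ltn_trans.
  - by rewrite size_mask.
  - by rewrite size_mask.
by rewrite big_const_seq count_predT iter_addn_0 size_splittings mulnC /nlab -/nlab !ndir_node.
Qed.
End SizeLabelingsNode.

Lemma size_labelings d t L R : sorted ltn (L ++ R) ->
  size L = ndir false d t -> size R = ndir true d t -> size (labelings d t L R) = nlab t.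
Proof.
elim: t d L R => [|a IHa b IHb] d L R sLR sL sR; first exact: labelings_leaf.
rewrite !ndir_node in sL sR.
by apply: size_labelings_node => // L' R' ? ? ?; [apply: IHa|apply: IHb].
Qed.

Lemma nleft_ndir t : nleft t = ndir false true t.
Proof.
rewrite /nleft /ndir -map_last_leaves count_map; apply: eq_count => e /=.
by rewrite /left_pointing /right_pointing; case: last.
Qed.

Lemma nright_ndir t : nright t = ndir true true t.
Proof.
rewrite /nright /ndir -map_last_leaves count_map; apply: eq_count => e /=.
by rewrite /right_pointing; case: last.
Qed.

Lemma all_zip_mask (S T : Type) (p : pred S) (q : pred T) (s : seq S) (w : seq T) :
  size w = size s ->
  all (fun x => p x.1 ==> q x.2) (zip s w) = all q (mask (map p s) w).
Proof. by elim: s w => [|x s IH] [|y w] //= [/IH->]; case: (p x). Qed.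

Lemma left_below_rightE t w : size w = nleaves t ->
  left_below_right t w = allrel ltn (lefts true t w) (rights true t w).
Proof.
move=> sw; have swl : size w = size (leaves t) by rewrite size_leaves.
rewrite /lefts /rights -map_last_leaves -map_comp /allrel.
rewrite -(all_zip_mask left_pointing _ swl); apply: eq_all => p /=.
rewrite -(all_zip_mask right_pointing _ swl).
by case: left_pointing => //=; elim: (zip _ _).
Qed.

(** Sorting left and right labels separately and concatenating gives 1, ..., n in order, so the left
    labels come first. This identifies the condition with the one in [labelings]. *)
Lemma left_below_right_iota t w : perm_eq w (iota 1 (nleaves t)) ->
  left_below_right t w = perm_eq (lefts true t w) (iota 1 (nleft t)).
Proof.
move=> wn; have sw : size w = nleaves t by rewrite (perm_size wn) size_iota.
have lr := perm_lefts_rights true sw; have sl := size_lefts true sw.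
rewrite left_below_rightE // nleft_ndir; rewrite -(ndirD true) iotaD in wn.
set l := lefts _ _ _ in lr sl *; set r := rights _ _ _ in lr *.
have lrn := perm_trans lr wn.
apply/idP/idP => [lbr|pl].
  have sorted_lr : sorted leq (sort leq l ++ sort leq r).
    rewrite (sorted_pairwise leq_trans) pairwise_cat -!(sorted_pairwise leq_trans).
    rewrite !(sort_sorted leq_total) !andbT; apply/allrelP => x y.
    by rewrite !mem_sort => xl yr; apply: ltnW; apply: (allrelP lbr).
  have E : sort leq l ++ sort leq r = iota 1 (ndir false true t) ++ iota (1 + ndir false true t) (ndir true true t).
    apply: (sorted_eq leq_trans anti_leq) => //; first by rewrite -iotaD iota_sorted.
    by rewrite -(permPr lrn) perm_cat ?perm_sort.
  have := congr1 (take (size (sort leq l))) E; rewrite take_size_cat // size_sort sl.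
  rewrite take_size_cat ?size_iota // => <-.
  by rewrite perm_sym perm_sort.
have pr : perm_eq r (iota (1 + ndir false true t) (ndir true true t)).
  by rewrite -(perm_cat2l (iota 1 (ndir false true t))) -(permPr lrn) perm_cat2r perm_sym.
apply/allrelP => x y; rewrite (perm_mem pl) (perm_mem pr) !mem_iota.
by move=> /andP[_ xl] /andP[ly _]; apply: leq_trans xl ly.
Qed.

Lemma nlabelings_nlab t : nlabelings t = nlab t.
Proof.
rewrite -(size_labelings (d := true) (L := iota 1 (ndir false true t))
  (R := iota (1 + ndir false true t) (ndir true true t))) ?size_iota //; last first.
  by rewrite -iotaD iota_ltn_sorted.
rewrite /nlabelings /labelings -iotaD ndirD -size_filter; congr size.
apply: eq_in_filter => w; rewrite mem_permutations => wn.
by rewrite (left_below_right_iota wn) nleft_ndir.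
Qed.

(** The absorption identity n C(n+m, n) = (n+m) C(n+m-1, n-1) with denominators cleared; it matches
    the binomials of [nlab] with the ratios in [coef]. *)
Lemma bin_factM n m : (0 < n)%N ->
  ('C((n + m).-1, n.-1) * n`! * m`! * (n + m) = n * (n + m)`!)%N.
Proof.
case: n => // n _; rewrite addSn /= [(n + m).+1`!]factS [n.+1`!]factS.
have := bin_fact (leq_addr m n); rewrite addKn => <-.
by rewrite mulnCA -!mulnA (mulnC (n + m).+1) -!mulnA.
Qed.

Lemma bin_factM_rev n m : (0 < m)%N ->
  ('C((n + m).-1, n) * n`! * m`! * (n + m) = m * (n + m)`!)%N.
Proof.
case: m => // m m0; rewrite (addnC n) -(bin_factM n m0) /=.
by rewrite -(bin_sub (leq_addr n m)) addKn -(mulnA _ n`!) (mulnC n`!) mulnA.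
Qed.

Section Coefficients.
Variable k : fieldType.
Hypothesis char0 : [pchar k] =i pred0.

(** The direction [d] is free because it only affects the leaf, where both factorials are 1; the
    induction needs it left pointing for [a] and right pointing for [b]. *)
Lemma nlab_coef d t :
  (nlab t)%:R = coef k t * ((ndir false d t)`! * (ndir true d t)`!)%:R.
Proof.
elim: t d => [|a IHa b IHb] d; first by case: d; rewrite /ndir /= mulr1.
have [la0 rb0] := (ndir_gt0 false a, ndir_gt0 true b).
rewrite /nlab -/nlab /coef -/coef !natrM (IHa false) (IHb true) !ndir_node.
have := congr1 (fun n => n%:R : k) (bin_factM (ndir false true b) la0).
have := congr1 (fun n => n%:R : k) (bin_factM_rev (ndir true false a) rb0).
have lN : (ndir false false a + ndir false true b)%:R != 0 :> k.
  by rewrite natf_neq0_char0 // addn_gt0 la0.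
have rN : (ndir true false a + ndir true true b)%:R != 0 :> k.
  by rewrite natf_neq0_char0 // addn_gt0 rb0 orbT.
have alg (C1 C2 x1 x2 y1 y2 l r lf rf p q u v : k) : l != 0 -> r != 0 ->
    C2 * x2 * y2 * r = q * rf -> C1 * x1 * y1 * l = p * lf ->
    C1 * C2 * (u * (x1 * x2) * (v * (y1 * y2))) = p * q / (l * r) * (u * v) * (lf * rf).
  move=> l0 r0 Er El; transitivity ((p * lf) * (q * rf) * (u * v) / (l * r)).
    by rewrite -Er -El; field; rewrite l0 r0.
  by field; rewrite l0 r0.
by rewrite !natrM; apply: alg.
Qed.

Lemma nlabelings_coef t :
  (nlabelings t)%:R / ((nleft t)`! * (nright t)`!)%:R = coef k t.
Proof.
rewrite nlabelings_nlab (nlab_coef true) nleft_ndir nright_ndir mulfK //.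
by rewrite natf_neq0_char0 // muln_gt0 !fact_gt0.
Qed.

End Coefficients.

(** * The Dynkin operator *)

Section Dynkin.
Variables (k : fieldType) (char0 : [pchar k] =i pred0).
Variables (g : lmodType k) (br : g -> g -> g) (hbr : lie_bracket br) (x y : g).
Implicit Types (f h : ncalg k) (w : seq bool) (P Q : lie_poly k) (u v : g).

Lemma br_linearr u : linear (br u).
Proof. by move=> a v w; apply: lie_linearr. Qed.
HB.instance Definition _ u := GRing.isLinear.Build k g g *:%R (br u) (br_linearr u).

Lemma br_anti u v : br u v = - br v u.
Proof.
have := lie_alternating hbr (1 *: u + v).
rewrite (lie_linearl hbr) !(lie_linearr hbr) !scale1r !(lie_alternating hbr) add0r addr0.
by move=> /eqP; rewrite addr_eq0 => /eqP.
Qed.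

Lemma br_suml I (r : seq I) (p : pred I) (F : I -> g) v :
  br (\sum_(i <- r | p i) F i) v = \sum_(i <- r | p i) br (F i) v.
Proof. by rewrite br_anti linear_sum -sumrN; apply: eq_bigr => i _; rewrite -br_anti. Qed.

Lemma brZl a u v : br (a *: u) v = a *: br u v.
Proof. by rewrite br_anti linearZ -scalerN -br_anti. Qed.

Lemma br_jacobi u v z : br (br u v) z = br u (br v z) - br v (br u z).
Proof.
rewrite (br_anti (br u v)) (br_anti u z) raddfN /= opprK; apply/esym/eqP.
by rewrite -addr_eq0 lie_jacobi.
Qed.

Definition letter (b : bool) : g := if b then y else x.
Definition ad w v : g := foldr (fun b => br (letter b)) v w.

(* Right-normed iterated brackets; the value at [::] is junk. *)
Fixpoint rnb w : g :=
  match w with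
  | [::] => 0
  | [:: b] => letter b
  | b :: w' => br (letter b) (rnb w')
  end.

Lemma rnb_cat w w' : w' != [::] -> rnb (w ++ w') = ad w (rnb w').
Proof.
move=> w'0; elim: w => //= b w <-.
by case: (w ++ w') (size_cat w w') => // /esym/eqP; rewrite addn_eq0 => /andP[_ /nilP]; move: w'0 => /eqP.
Qed.

(* The sum of f w *: al w over the words w of length n. *)
Fixpoint wsum n (al : seq bool -> g) f : g :=
  if n is n'.+1 then
    wsum n' (fun w => al (false :: w)) (shift false f) + wsum n' (fun w => al (true :: w)) (shift true f)
  else f [::] *: al [::].

Lemma wsum_linear n al : linear (wsum n al).
Proof.
elim: n al => [|n IH] al a f h /=; first by rewrite scalerDl scalerA.
have sh b : shift b (a *: f + h) = a *: shift b f + shift b h by [].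
by rewrite !sh !IH scalerDr addrACA.
Qed.
HB.instance Definition _ n al :=
  GRing.isLinear.Build k (ncalg k) g *:%R (wsum n al) (wsum_linear n al).

Lemma eq_wsum n al be f h : (forall w, size w = n -> f w *: al w = h w *: be w) ->
  wsum n al f = wsum n be h.
Proof.
elim: n al be f h => [|n IH] al be f h E /=; first exact: E.
by congr (_ + _); apply: IH => w wn; apply: E; rewrite /= wn.
Qed.

Lemma wsum0 n al f : (forall w, size w = n -> f w *: al w = 0) -> wsum n al f = 0.
Proof.
move=> E; rewrite -[RHS](linear0 (wsum n al)); apply: eq_wsum => w wn.
by rewrite E // nc_zeroE scale0r.
Qed.

Lemma wsum_comp n (L : {linear g -> g}) al f : wsum n (fun w => L (al w)) f = L (wsum n al f).
Proof.
elim: n al f => [|n IH] al f /=; first by rewrite linearZ.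
by rewrite linearD !IH.
Qed.

Lemma wsum_mul n al f h : wsum n al (f * h) =
  \sum_(i < n.+1) wsum i (fun w => wsum (n - i)%N (fun w' => al (w ++ w')) h) f.
Proof.
elim: n al f => [|n IH] al f.
  by rewrite big_ord1 /= -nc_mulE nc_mul0 scalerA.
rewrite big_ord_recl /= -!nc_mulE !shift_mul !linearD !linearZ /= !nc_mulE !IH.
rewrite addrACA -scalerDr; congr (_ + _).
by rewrite -big_split; apply: eq_bigr => i _.
Qed.

Lemma wsum_xvar n al b : wsum n al (xvar k b) = if n == 1%N then al [:: b] else 0.
Proof.
case: n => [|[|n]] /=; first by rewrite scale0r.
  by rewrite /shift /xvar /nc_var; case: b; rewrite /= scale1r scale0r ?add0r ?addr0.
by apply: (@wsum0 n.+2) => w wn; rewrite /xvar /nc_var; case: eqP wn => [->|]; rewrite ?scale0r.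
Qed.

Definition nc_eval P : ncalg k := lie_eval (@nc_comm k) (nc_var k false) (nc_var k true) P.

Lemma nc_eval_var b : nc_eval (LieVar k b) = xvar k b.
Proof. by case: b. Qed.

Lemma nc_evalD P Q : nc_eval (LieAdd P Q) = nc_eval P + nc_eval Q. Proof. by []. Qed.
Lemma nc_evalZ a P : nc_eval (LieScale a P) = a *: nc_eval P. Proof. by []. Qed.
Lemma nc_eval_br P Q : nc_eval (LieBr P Q) = nc_eval P * nc_eval Q - nc_eval Q * nc_eval P.
Proof. by []. Qed.

Lemma nc_eval_nil P : nc_eval P [::] = 0.
Proof.
elim: P => [[]|P IHP Q IHQ|a P IHP|P IHP Q IHQ] //.
- by rewrite -[RHS](addr0 0) -{1}IHP -IHQ.
- by rewrite -(mulr0 a) -IHP.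
- by rewrite nc_eval_br nc_subE -!nc_mulE !nc_mul0 IHP IHQ mulr0 subrr.
Qed.

(* The value at (x, y) of the part of P that is homogeneous of degree n. *)
Fixpoint homog n P : g :=
  match P with
  | LieVar b => if n == 1%N then letter b else 0
  | LieAdd P Q => homog n P + homog n Q
  | LieScale a P => a *: homog n P
  | LieBr P Q => \sum_(i < n.+1) br (homog i P) (homog (n - i)%N Q)
  end.

Lemma comp0 P : homog 0 P = 0.
Proof.
elim: P => [b|P IHP Q IHQ|a P IHP|P IHP Q IHQ] //=; first by rewrite IHP IHQ addr0.
  by rewrite IHP scaler0.
by rewrite big_ord1 IHQ linear0.
Qed.

Lemma ad_is_linear w : linear (ad w).
Proof. by move=> a u v; elim: w => //= b w ->; rewrite linearP. Qed.
HB.instance Definition _ w := GRing.isLinear.Build k g g *:%R (ad w) (ad_is_linear w).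

(** The adjoint action turns words into operators on [g] compatibly with products, hence commutators
    of series into ad of brackets, degree by degree. *)
Lemma wsum_ad n P v : wsum n (ad^~ v) (nc_eval P) = br (homog n P) v.
Proof.
elim: P n v => [b|P IHP Q IHQ|a P IHP|P IHP Q IHQ] n v /=.
- by rewrite nc_eval_var wsum_xvar; case: eqP => // _; rewrite br_anti linear0 oppr0.
- by rewrite nc_evalD linearD /= IHP IHQ -[br (_ + _) v]opprK -br_anti linearD opprD -!br_anti.
- by rewrite nc_evalZ linearZ /= IHP brZl.
have M P' Q' : (forall n v, wsum n (ad^~ v) (nc_eval P') = br (homog n P') v) ->
    (forall n v, wsum n (ad^~ v) (nc_eval Q') = br (homog n Q') v) ->
    wsum n (ad^~ v) (nc_eval P' * nc_eval Q')
      = \sum_(i < n.+1) br (homog i P') (br (homog (n - i)%N Q') v).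
  move=> EP EQ; rewrite wsum_mul; apply: eq_bigr => i _.
  rewrite -EP; apply: eq_wsum => w _; congr (_ *: _); rewrite /=.
  by rewrite -EQ -(wsum_comp _ (ad w)); apply: eq_wsum => w' _; rewrite /ad foldr_cat.
rewrite nc_eval_br linearB /= !M //.
rewrite br_suml [X in _ - X](reindex_inj rev_ord_inj) /= -sumrB; apply: eq_bigr => i _.
by rewrite br_jacobi subSS subKn // -ltnS.
Qed.

(* The Dynkin-Specht-Wever identity, with the free Lie algebra replaced by g. *)
Lemma wsum_rnb n P : wsum n rnb (nc_eval P) = n%:R *: homog n P.
Proof.
elim: P n => [b|P IHP Q IHQ|a P IHP|P IHP Q IHQ] n /=.
- by rewrite nc_eval_var wsum_xvar; case: eqP => [->|]; rewrite ?scale1r ?scaler0.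
- by rewrite nc_evalD linearD /= IHP IHQ scalerDr.
- by rewrite nc_evalZ linearZ /= IHP !scalerA mulrC.
have M P' Q' : (forall n, wsum n rnb (nc_eval Q') = n%:R *: homog n Q') ->
    wsum n rnb (nc_eval P' * nc_eval Q')
      = \sum_(i < n.+1) (n - i)%:R *: br (homog i P') (homog (n - i)%N Q').
  move=> EQ; rewrite wsum_mul; apply: eq_bigr => i _.
  rewrite -linearZ /= -wsum_ad; apply: eq_wsum => w _; congr (_ *: _).
  (* A nonempty suffix is bracketed first and then acted on by the prefix; the empty suffix, where
     [rnb] is junk, has coefficient 0. *)
  rewrite -EQ -(wsum_comp (n - i)%N (ad w : {linear g -> g})); apply: eq_wsum => -[|b w'] wn.
    by rewrite nc_eval_nil !scale0r.
  by rewrite rnb_cat.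
rewrite nc_eval_br linearB /= !M //.
rewrite [X in _ - X](reindex_inj rev_ord_inj) /= -sumrB scaler_sumr; apply: eq_bigr => i _.
have ni : (i <= n)%N by rewrite -ltnS.
(* The two products contribute n - i and i times the same bracket, n times in total. *)
rewrite subSS subKn // (br_anti (homog (n - i)%N Q)) scalerN opprK -scalerDl.
by rewrite -natrD subnK.
Qed.

Fixpoint deg P : nat :=
  match P with
  | LieVar _ => 1
  | LieAdd P Q => maxn (deg P) (deg Q)
  | LieScale _ P => deg P
  | LieBr P Q => deg P + deg Q
  end.

Lemma comp_deg P n : (deg P < n)%N -> homog n P = 0.
Proof.
elim: P n => [b|P IHP Q IHQ|a P IHP|P IHP Q IHQ] n /=.
- by case: eqP => // ->.
- by rewrite gtn_max => /andP[Pn Qn]; rewrite IHP // IHQ // addr0.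
- by move=> Pn; rewrite IHP // scaler0.
move=> PQn; rewrite big1 // => i _; have [Pi|iP] := ltnP (deg P) i.
  by rewrite IHP // br_anti linear0 oppr0.
rewrite IHQ ?linear0 // ltn_subRL; apply: leq_ltn_trans PQn.
by rewrite leq_add2r.
Qed.

Lemma lie_eval_comp P M : (deg P < M)%N -> lie_eval br x y P = \sum_(n < M) homog n P.
Proof.
elim: P M => [b|P IHP Q IHQ|a P IHP|P IHP Q IHQ] M /=.
- case: M => [|[|M]] // _; rewrite 2!big_ord_recl /= big1 ?addr0 ?add0r //.
- by rewrite gtn_max => /andP[PM QM]; rewrite big_split -IHP // -IHQ.
- by move=> PM; rewrite -scaler_sumr -IHP.
move=> PQM.
have PM : (deg P < M)%N by apply: leq_ltn_trans PQM; apply: leq_addr.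
have QM : (deg Q < M)%N by apply: leq_ltn_trans PQM; apply: leq_addl.
rewrite (IHP _ PM) (IHQ _ QM) br_suml.
(* Pairs of degrees (i, j) are regrouped by n = i + j; those with i + j >= M vanish, as one of the
   degrees exceeds its bound. *)
transitivity (\sum_(i < M) \sum_(n < M | (i <= n)%N) br (homog i P) (homog (n - i)%N Q)).
  apply: eq_bigr => i _; rewrite linear_sum /=.
  rewrite -(big_mkord xpredT (fun j => br (homog i P) (homog j Q))).
  rewrite -(big_mkord (fun n => (i <= n)%N) (fun n => br (homog i P) (homog (n - i)%N Q))).
  rewrite -(big_nat_widenl i 0 M xpredT) //.
  have := big_addn 0 M i xpredT (fun n => br (homog i P) (homog (n - i)%N Q)).
  rewrite add0n => ->.
  under [RHS]eq_bigr do rewrite addnK.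
  rewrite [LHS](@big_cat_nat _ _ _ (M - i)) //= ?leq_subr // [X in _ + X]big_nat.
  rewrite [X in _ + X]big1 ?addr0 // => j /andP[Mj _].
  have [Pi|iP] := ltnP (deg P) i; first by rewrite comp_deg // br_anti linear0 oppr0.
  rewrite [homog j Q]comp_deg ?linear0 //; apply: leq_trans Mj; rewrite ltn_subRL.
  by apply: leq_ltn_trans PQM; rewrite leq_add2r.
rewrite (exchange_big_dep xpredT) //=; apply: eq_bigr => n _.
by rewrite [RHS](big_ord_widen_cond M xpredT (fun i => br (homog i P) (homog (n - i)%N Q))).
Qed.

(** By the Dynkin identity n times the degree n part depends only on the series, and a positive n is
    invertible. *)
Lemma comp_nc_eval n P Q : nc_eval P = nc_eval Q -> homog n P = homog n Q.
Proof.
move=> E; case: n => [|n]; first by rewrite !comp0.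
have := wsum_rnb n.+1 P; rewrite E wsum_rnb => /(scalerI _)-> //.
exact: natf_neq0_char0.
Qed.

(** Makes the value at (x, y) independent of the Lie polynomials chosen in [bch_value] to represent
    the homogeneous parts. *)
Lemma lie_eval_nc_eval P Q : nc_eval P = nc_eval Q -> lie_eval br x y P = lie_eval br x y Q.
Proof.
move=> E; have [lP lQ] := (leq_maxl (deg P) (deg Q), leq_maxr (deg P) (deg Q)).
rewrite (lie_eval_comp (M := (maxn (deg P) (deg Q)).+1)) //.
rewrite (lie_eval_comp (P := Q) (M := (maxn (deg P) (deg Q)).+1)) //.
by apply: eq_bigr => i _; apply: comp_nc_eval.
Qed.

Lemma lie_eval_homogeneous n P : (forall w, size w != n -> nc_eval P w = 0) ->
  lie_eval br x y P = homog n P.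
Proof.
move=> hP; pose M := (maxn (deg P) n).+1.
have nM : (n < M)%N by rewrite ltnS leq_maxr.
rewrite (lie_eval_comp (M := M)) ?ltnS ?leq_maxl //.
rewrite (bigD1 (Ordinal nM)) //= big1 ?addr0 // => -[[|i] iM] /= ni; first exact: comp0.
have /esym/eqP := wsum_rnb i.+1 P; rewrite wsum0 => [|w wi]; last first.
  by rewrite hP ?scale0r // wi.
by rewrite scaler_eq0 (negPf (natf_neq0_char0 char0 _)) //= => /eqP.
Qed.

End Dynkin.

(** * Summation in a pro-nilpotent Lie algebra *)

Fixpoint tree_lie (k : fieldType) (d : bool) (t : pbtree) : lie_poly k :=
  if t is Node a b then LieBr (tree_lie k false a) (tree_lie k true b) else LieVar k d.

Definition tree_poly (k : fieldType) (t : pbtree) : lie_poly k :=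
  if t is Leaf then LieAdd (LieVar k false) (LieVar k true) else tree_lie k true t.

(** The recursion ends in a zero multiple of a variable, since [lie_poly] has no zero. *)
Definition lie_sum (k : fieldType) (T : Type) (c : T -> k) (P : T -> lie_poly k) (r : seq T) :=
  foldr (fun t Q => LieAdd (LieScale (c t) (P t)) Q) (LieScale 0 (LieVar k true)) r.

Lemma lie_eval_tree_poly (k : fieldType) (g : lmodType k) (br : g -> g -> g) (x y : g) t :
  lie_eval br x y (tree_poly k t) = tree_bracket br t x y.
Proof.
case: t => // a b; rewrite /tree_poly /tree_bracket; set t := Node a b.
by elim: t true => [|? IHa ? IHb] d //=; rewrite IHa IHb.
Qed.

Lemma lie_eval_sum (k : fieldType) (g : lmodType k) (br : g -> g -> g) (x y : g)
    T (c : T -> k) (P : T -> lie_poly k) (r : seq T) :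
  lie_eval br x y (lie_sum c P r) = \sum_(t <- r) c t *: lie_eval br x y (P t).
Proof. by elim: r => [|t r IH] /=; rewrite ?big_nil ?scale0r // big_cons IH. Qed.

Lemma phi_tree_poly (k : fieldType) t : phi k t = coef k t *: nc_eval (tree_poly k t).
Proof.
case: t => [|a b]; first by rewrite scale1r.
rewrite /phi /tree_poly; congr (_ *: _); elim: (Node a b) true => [|? IHa ? IHb] d //=.
  by case: d.
by rewrite nc_eval_br IHa IHb.
Qed.

Fixpoint trees_below (n : nat) : seq pbtree :=
  if n is m.+1 then trees_below m ++ trees m else [::].

Lemma mem_trees_below n t : (t \in trees_below n) = (nleaves t < n)%N.
Proof. by elim: n => //= n IH; rewrite mem_cat IH mem_trees ltnS [RHS]leq_eqVlt orbC. Qed.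

Lemma trees_below_uniq n : uniq (trees_below n).
Proof.
elim: n => //= n IH; rewrite cat_uniq IH trees_uniq andbT; apply/hasPn => t.
by rewrite mem_trees mem_trees_below -leqNgt => /eqP->.
Qed.

(** Allows homogeneity of [tree_poly] to be deduced from that of [phi]. *)
Lemma coef_neq0 (k : fieldType) (char0 : [pchar k] =i pred0) t : coef k t != 0.
Proof.
elim: t => [|a IHa b IHb]; first exact: oner_neq0.
rewrite /coef -/coef !mulf_neq0 ?invr_eq0 ?natf_neq0_char0 ?muln_gt0 ?ndir_gt0 //.
by rewrite !ndir_node_gt0.
Qed.

Section Summation.
Variables (k : fieldType) (g : lmodType k) (br : g -> g -> g).
Variables (J : Type) (F : J -> set g) (hF : pronilpotent br F).

Lemma idealD j u v : F j u -> F j v -> F j (u + v).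
Proof. by move=> Fu Fv; rewrite -[u]scale1r; apply: (ideal_linear (pro_ideal hF j)). Qed.

Lemma idealZ j a u : F j u -> F j (a *: u).
Proof.
move=> Fu; rewrite -[_ *: _]addr0; apply: (ideal_linear (pro_ideal hF j)) => //.
exact: ideal0 (pro_ideal hF j).
Qed.

Lemma idealN j u : F j u -> F j (- u).
Proof. by rewrite -scaleN1r; apply: idealZ. Qed.

Lemma ideal_sum j (I : eqType) (r : seq I) (f : I -> g) :
  (forall i, i \in r -> F j (f i)) -> F j (\sum_(i <- r) f i).
Proof.
move=> H; rewrite big_seq; apply: (big_ind (F j)) => //; last exact: idealD.
exact: ideal0 (pro_ideal hF j).
Qed.

Lemma sums_to_tail (I : eqType) (f : I -> g) z :
  (forall j, exists s : seq I, [/\ uniq s, forall i, i \notin s -> F j (f i)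
     & F j (\sum_(i <- s) f i - z)]) ->
  sums_to F f z.
Proof.
move=> H j; have [s [us tail sz]] := H j; exists s => s' us' ss'.
have /(perm_big _)-> : perm_eq s' (s ++ [seq i <- s' | i \notin s]).
  apply: uniq_perm => //; last first.
    by move=> i; rewrite mem_cat mem_filter; case: (boolP (i \in s)) => // /ss' ->.
  rewrite cat_uniq us filter_uniq // andbT; apply/hasPn => i.
  by rewrite mem_filter => /andP[].
rewrite big_cat addrAC; apply: idealD => //; apply: ideal_sum => i.
by rewrite mem_filter => /andP[/tail].
Qed.

Lemma sums_to_unique (I : eqType) (f : I -> g) z z' :
  sums_to F f z -> sums_to F f z' -> z = z'.
Proof.
move=> fz fz'; apply/eqP; rewrite -subr_eq0; apply/eqP/(pro_separated hF) => j.
have [[s sz] [s' sz']] := (fz j, fz' j); pose r := undup (s ++ s').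
have Fz : F j (\sum_(i <- r) f i - z).
  by apply: sz (undup_uniq _) _ => i; rewrite mem_undup mem_cat => ->.
have Fz' : F j (\sum_(i <- r) f i - z').
  by apply: sz' (undup_uniq _) _ => i; rewrite mem_undup mem_cat orbC => ->.
have -> : z - z' = - (\sum_(i <- r) f i - z) + (\sum_(i <- r) f i - z').
  by rewrite opprB subrKA.
by apply: idealD => //; apply: idealN.
Qed.

Lemma tree_sum_tail j (f : pbtree -> g) m n : (m <= n)%N ->
  (forall t, (m <= nleaves t)%N -> F j (f t)) ->
  F j (\sum_(t <- trees_below n) f t - \sum_(t <- trees_below m) f t).
Proof.
move=> mn tail; elim: n mn => [|n IH].
  by rewrite leqn0 => /eqP->; rewrite subrr; apply: ideal0 (pro_ideal hF j).
rewrite leq_eqVlt => /predU1P[<-|mn]; first by rewrite subrr; apply: ideal0 (pro_ideal hF j).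
rewrite big_cat addrAC; apply: idealD; first exact: IH.
by apply: ideal_sum => t; rewrite mem_trees => /eqP tn; apply: tail; rewrite tn.
Qed.

(** The sums over trees with fewer than [N j] leaves are compatible modulo the ideals, so
    completeness yields a limit; grouping the trees by number of leaves has the same limit. *)
Lemma tree_summable (f : pbtree -> g) :
  (forall j, exists n, forall t, (n <= nleaves t)%N -> F j (f t)) ->
  exists z, sums_to F f z /\ sums_to F (fun n => \sum_(t <- trees n) f t) z.
Proof.
move=> /choice[N tail].
have [i j Fij|z zP] := pro_complete hF (u := fun j => \sum_(t <- trees_below (N j)) f t).
  (* If [N i] is the smaller bound, the difference lies in [F i], which is contained in [F j]. *)
  have [NN|/ltnW NN] := leqP (N i) (N j).
    rewrite -opprB; apply: idealN; apply: tree_sum_tail => // t /tail; exact: Fij.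
  by apply: tree_sum_tail => // t; apply: tail.
exists z; split; apply: sums_to_tail => j.
  exists (trees_below (N j)); split=> //; first exact: trees_below_uniq.
  by move=> t; rewrite mem_trees_below -leqNgt; apply: tail.
exists (iota 0 (N j)); split; first exact: iota_uniq.
  move=> n; rewrite mem_iota -leqNgt => Nn; apply: ideal_sum => t.
  by rewrite mem_trees => /eqP tn; apply: tail; rewrite tn.
suff -> : \sum_(n <- iota 0 (N j)) \sum_(t <- trees n) f t = \sum_(t <- trees_below (N j)) f t by [].
elim: (N j) => [|n IH]; first by rewrite !big_nil.
by rewrite -addn1 iotaD !addn1 /= !big_cat big_seq1 IH.
Qed.

End Summation.

(** * Brackets of trees with many leaves lie in a given ideal *)

Section DeepBrackets.
Variables (k : fieldType) (char0 : [pchar k] =i pred0).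
Variables (g : lmodType k) (br : g -> g -> g) (hbr : lie_bracket br) (x y : g).
Variables (J : Type) (F : J -> set g) (hF : pronilpotent br F).

Lemma ideal_wsum j n (al : seq bool -> g) (f : ncalg k) :
  (forall w, size w = n -> F j (al w)) -> F j (wsum n al f).
Proof.
elim: n al f => [|n IH] al f H /=; first by apply: (idealZ hF); apply: H.
by apply: (idealD hF); apply: IH => w wn; apply: H; rewrite /= wn.
Qed.

(** Nilpotency modulo [F j] applies to the n outer brackets; the strict inequality keeps a letter
    inside them. *)
Lemma deep_rnb j : exists n, forall w, (n < size w)%N -> F j (rnb br x y w).
Proof.
have [n Fn] := pro_nilpotent hF j; exists n => w nw.
rewrite -(cat_take_drop n w) rnb_cat; last by rewrite -size_eq0 size_drop subn_eq0 -ltnNge.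
rewrite /ad -foldr_map; apply: Fn.
by rewrite size_map size_takel // ltnW.
Qed.

(** Nilpotency directly concerns right-normed brackets only; the Dynkin identity writes any tree
    bracket as a combination of right-normed brackets of the same length. *)
Lemma deep_tree_bracket j : exists n, forall t, (n <= nleaves t)%N -> F j (tree_bracket br t x y).
Proof.
have [n Fn] := deep_rnb j; exists n.+1 => t nt.
have c0 : (nleaves t)%:R != 0 :> k by rewrite natf_neq0_char0 ?nleaves_gt0.
have cf0 := coef_neq0 char0 t.
rewrite -(lie_eval_tree_poly (k := k)) (lie_eval_homogeneous char0 hbr x y (n := nleaves t)).
  rewrite -[homog _ _ _ _ _](scalerK c0) -wsum_rnb //; apply: (idealZ hF).
  by apply: ideal_wsum => w wt; apply: Fn; rewrite wt.
move=> w wt; have := @graded_phi k t w wt; rewrite phi_tree_poly nc_scaleE => /eqP.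
by rewrite mulf_eq0 (negPf cf0) => /eqP.
Qed.

End DeepBrackets.

Theorem theoremC2 (k : fieldType) (char0 : [pchar k] =i pred0)
    (g : lmodType k) (br : g -> g -> g) (hbr : lie_bracket br)
    (J : Type) (F : J -> set g) (hF : pronilpotent br F) (x y : g) :
  sums_to F
    (fun t : pbtree =>
       (eulerian k t * (nlabelings t)%:R / ((nleft t)`! * (nright t)`!)%:R)
       *: tree_bracket br t x y)
    (bch br F x y).
Proof.
pose c t : k := eulerian k t * coef k t.
have cE : (fun t => (eulerian k t * (nlabelings t)%:R / ((nleft t)`! * (nright t)`!)%:R)
       *: tree_bracket br t x y) = (fun t => c t *: tree_bracket br t x y).
  by apply/funext => t; rewrite -mulrA nlabelings_coef.
(* [P n] is the degree n part of the sum over trees; [P_nc] makes it an admissible choice of Lie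
   polynomials in [bch_value]. *)
rewrite {}cE; pose P n := lie_sum c (tree_poly k) (trees n).
have PE (h : lmodType k) (bh : h -> h -> h) u v n :
    lie_eval bh u v (P n) = \sum_(t <- trees n) c t *: tree_bracket bh t u v.
  by rewrite lie_eval_sum; apply: eq_bigr => t _; rewrite lie_eval_tree_poly.
have P_nc n : lie_eval (@nc_comm k) (nc_var k false) (nc_var k true) (P n)
    = nc_homogeneous_part n (nc_bch k).
  apply/funext => w; rewrite /nc_homogeneous_part lie_eval_sum.
  have -> : nc_bch k w = psum (eulerian k) w by rewrite nc_bch_psum.
  rewrite -/(nc_eval _).
  have cphi t : (c t *: nc_eval (tree_poly k t) : ncalg k) w = eulerian k t * phi k t w.
    by rewrite phi_tree_poly !nc_scaleE mulrA.
  transitivity (\sum_(t <- trees n) eulerian k t * phi k t w).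
    rewrite -[LHS]/((\sum_(t <- trees n) c t *: nc_eval (tree_poly k t) : ncalg k) w) nc_sumE.
    by apply: eq_bigr => t _; rewrite cphi.
  case: eqP => [<-|/eqP wn] //; rewrite big_seq big1 // => t; rewrite mem_trees => /eqP tn.
  by rewrite graded_phi ?mulr0 // tn.
have [j|z [tz nz]] := tree_summable hF (f := fun t => c t *: tree_bracket br t x y).
  have [n Fn] := deep_tree_bracket char0 hbr x y hF j.
  by exists n => t /Fn; apply: (idealZ hF).
have zP : bch_value br F x y z.
  exists P; split=> // j; have [s sP] := nz j; exists s => s' us' ss'.
  by under eq_bigr do rewrite PE; apply: sP.
(* [bch] is chosen among all values, so it comes with its own Lie polynomials [P'], possibly
   different from [P] but with the same series. *)
have [P' [P'nc P'z]] : bch_value br F x y (bch br F x y) by exact: (xgetI _ zP).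
suff -> : bch br F x y = z by [].
apply: (sums_to_unique hF P'z) => j; have [s sP] := nz j; exists s => s' us' ss'.
under eq_bigr => n _.
  rewrite (_ : lie_eval br x y (P' n) = lie_eval br x y (P n)); last first.
    by apply: (lie_eval_nc_eval char0 hbr); rewrite /nc_eval P'nc P_nc.
  rewrite PE; over.
exact: sP.
Qed.
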